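(* Let $V$ be a complex Banach space and $H$ a complex Hilbert space with $V\subset H$ (as a linear subspace) and $\|v\|_V\ge\|v\|_H$ for all $v\in V$. Let $T\in(0,\infty)$ and $p\in[1,\infty)$. Let $v_t$, $t\in[0,T]$, be a $V$-valued strongly (Lebesgue) measurable function, and let $v^*_t$, $t\in[0,T]$, be a $V^*$-valued function such that: (i) for every $v\in V$, $\langle v^*_t,v\rangle$ is a measurable function of $t\in[0,T]$; (ii) there is a measurable function $f_t$ on $[0,T]$ such that $\|v^*_t\|_{V^*}\le f_t$ for $t\in[0,T]$; (iii) there is a constant $N_0\in[1,\infty)$ such that, if $p>1$, $$\int_0^T\big(\|v_t\|_V^p+f_t^{p'}\big)\,dt\le N_0,\qquad p'=p/(p-1),$$ and, if $p=1$, $$\int_0^T\|v_r\|_V\,dr+f_t\le N_0\quad\text{for almost every } t\in[0,T].$$ Assume also that for every $v\in V$, for almost all $s,t\in[0,T]$, $$(v_t,v)_H-(v_s,v)_H=\int_s^t\langle v^*_r,v\rangle\,dr.$$ Then there exists an $H$-valued $H$-strongly continuous function $u_t$, $t\in[0,T]$, such that $u_t=v_t$ for almost all $t\in[0,T]$, and for all $t\in[0,T]$ and $v\in V$ $$(u_t,v)_H=(u_0,v)_H+\int_0^t\langle v^*_s,v\rangle\,ds.$$ Furthermore, for all $t\in[0,T]$ $$\|u_t\|_H^2=\|u_0\|_H^2+2\int_0^t\Re\langle v^*_s,u_s\rangle\,ds.$$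
   Context: $(\cdot,\cdot)_H$ is the scalar product of $H$, linear in the first argument and conjugate-linear in the second. $V^*$ is the dual space of $V$, and $\langle v^*,v\rangle$ ($v^*\in V^*$, $v\in V$) is the pairing, which is linear in $v^*$ and conjugate-linear in $v$ (i.e. elements of $V^*$ act as bounded conjugate-linear functionals on $V$), with $|\langle v^*,v\rangle|\le\|v^*\|_{V^*}\|v\|_V$. $V$ is not assumed reflexive, separable, or dense in $H$. Measurability and ''almost all'' refer to Lebesgue measure; ''for almost all $s,t\in[0,T]$'' means for almost all $(s,t)\in[0,T]^2$, and the exceptional set may depend on $v$. $\int_s^t=-\int_t^s$ if $s>t$. Since $u_s=v_s\in V$ for almost all $s$, the expression $\langle v^*_s,u_s\rangle$ is defined for almost all $s$. *)

(* Defs.v *)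
From HB Require Import structures.
From mathcomp Require Import all_boot all_order all_algebra.
From mathcomp Require Import complex.
From mathcomp Require Import all_classical all_reals all_analysis.

Set Implicit Arguments.
Unset Strict Implicit.
Unset Printing Implicit Defensive.

Import Order.TTheory GRing.Theory Num.Theory.
Import numFieldNormedType.Exports.

Local Open Scope classical_set_scope.
Local Open Scope ring_scope.

(* The norm of a normed space over R[i] takes its values in R[i]. *)
Definition rnorm {R : realType} {V : normedZmodType R[i]} (x : V) : R :=
  complex.Re `|x|.

(* The inner product is linear in its first argument and conjugate-linear in
   the second one, since {dot H for conj} is. *)
Definition inner_product_norm {R : realType} {H : normedModType R[i]}
    (ip : {dot H for @Num.conj R[i]}) : Prop :=
  forall x : H, `|x| ^+ 2 = ip x x.

(* V^* consists of the bounded conjugate-linear functionals on V, so that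
   <v^*, v> is linear in v^* and conjugate-linear in v. *)
Record antidual {R : realType} (V : normedModType R[i]) := Antidual {
  antidual_fun :> {linear V -> R[i] | @Num.conj R[i] \; *%R};
  antidual_bounded :
    exists M : R, forall v : V, rnorm (antidual_fun v) <= M * rnorm v }.

Definition dual_norm {R : realType} {V : normedModType R[i]}
    (phi : antidual V) : R :=
  sup [set rnorm (phi v) | v in [set v : V | rnorm v <= 1]].

(* <v^*, h> for h in H lying in V, where V is included in H through inc. The
   value is 0 when h is not in V. *)
Definition pairingH {R : realType} {V H : normedModType R[i]} (inc : V -> H)
    (phi : antidual V) (h : H) : R[i] :=
  if `[< range inc h >] then phi ('pinv_(fun=> 0) [set: V] inc h) else 0.

Definition strongly_measurable d {T : measurableType d} {R : realType}
    {V : normedModType R[i]} (mu : {measure set T -> \bar R}) (D : set T)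
    (f : T -> V) : Prop :=
  exists s : {fimfun T >-> V}^nat,
    (forall n x, measurable (s n @^-1` [set x])) /\
    {ae mu, forall t, D t -> s n t @[n --> \oo] --> f t}.

Definition measurable_complex d {T : measurableType d} {R : realType}
    (D : set T) (f : T -> R[i]) : Prop :=
  measurable_fun D (fun t => complex.Re (f t)) /\
  measurable_fun D (fun t => complex.Im (f t)).

(* Lebesgue measure on the sigma-algebra of Lebesgue (not only Borel)
   measurable sets. The carrier of lebesgueType R is R. *)
Definition lebesgueType (R : realType) : measurableType _ :=
  caratheodory_type ((wlength (@idfun R))^*)%mu.

Definition leb (R : realType) : {measure set (lebesgueType R) -> \bar R} :=
  @completed_lebesgue_measure R.

Definition complex_integral {R : realType} (D : set R) (f : R -> R[i]) : R[i] :=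
  Complex (\int[leb R]_(r in D) complex.Re (f r))
          (\int[leb R]_(r in D) complex.Im (f r)).

Definition oriented_integral {R : realType} (s t : R) (f : R -> R[i]) : R[i] :=
  if s <= t then complex_integral `[s, t] f else - complex_integral `[t, s] f.

(* Main.v *)
Require Import Defs.
From HB Require Import structures.
From mathcomp Require Import all_boot all_order all_algebra.
From mathcomp Require Import complex.
From mathcomp Require Import all_classical all_reals all_analysis.
From mathcomp Require Import measurable_realfun.
From mathcomp Require Import ring lra.
Set Implicit Arguments.
Unset Strict Implicit.
Unset Printing Implicit Defensive.
Import Order.TTheory GRing.Theory Num.Theory.
Import numFieldNormedType.Exports.
Local Open Scope classical_set_scope.
Local Open Scope ring_scope.

(** Write [g t] for [v t] seen in [H], [phi t] for the square of the norm of
    [g t], [<v*, v>] for the real part of the pairing, and, for [x] in [V], let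
    [F_x] be the primitive of [r |-> <v*_r, x>].

    The weak equation says that [Re (g t, x) - F_x t] is almost everywhere
    constant, for each [x] separately (Fubini).  The function [v] is almost
    everywhere a limit of simple functions, so almost all its values lie in the
    closure of a countable set; discarding one null set for each point of that
    set and passing to the limit makes [x = v r] admissible: on a set [S] of
    full measure,
      [Re (g t - g r, g r) = F_{v r} t - F_{v r} r]  ([weak_increment]), hence
      [phi t - phi r = 2 (F_{v r} t - F_{v r} r) + |g t - g r|^2]
    ([norm_increment]).

    Energy equality.  Drop the square: for [h > 0] the quotient
    [(phi (r + h) - phi r) / h] is at least twice the mean of
    [q |-> <v*_q, v r>] between [r] and [r + h], and at most twice that mean
    when [h < 0].  As [h] tends to 0 these means tend to [<v*_r, v r>] for almost
    every [r] ([prim_derivable]).  Integrated from [a] to [b], the quotient telescopes and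
    tends to [phi b - phi a] for almost all [a] and [b], so Fatou's lemma turns
    the two pointwise bounds into the two inequalities between [phi b - phi a]
    and twice the integral of [<v*, v>].  Fatou's lemma requires an integrable
    minorant.  Young's inequality gives
      [f q * |v r| <= alpha r + beta q] with [alpha] and [beta] integrable
    ([young_majorant]), so that the means are bounded by [alpha r] plus the mean
    of [beta]; adding to [phi] (or to [- phi]) twice a primitive of [beta]
    compensates the latter and leaves the minorant [- 2 alpha], which does not
    depend on [h] ([integral_le_increment], [one_sided_energy],
    [energy_identity]).

    Continuity.  With [K] and [B] primitives of [<v*, v>] and of [beta], the
    identities above give, on [S],
      [|g t - g r|^2 <= 2 |K t - K r| + 2 (alpha r * |t - r| + |B t - B r|)].
    A short interval around a given point contains some [r] at which [alpha r]
    times the length of the interval is at most about the integral of [alpha]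
    over it ([exists_le_mean]), and the comparison of all the points of the
    interval with this [r] shows that [g] is Cauchy there.  Hence [g] extends by
    continuity from [S] to a function [u] ([continuous_version]), and the
    identities, which hold on [S] with continuous sides, hold everywhere
    ([energy_equality]).

    Two reductions precede this.  Lebesgue measurable functions are replaced by
    Borel functions that agree with them almost everywhere, in order to use
    Lebesgue differentiation ([lebint_borel]).  Only real parts are treated: the
    imaginary part of a conjugate-linear quantity at [x] is its real part at
    [i x] ([antidual_Im], [ip_Im]). *)

Local Notation "x %:C" := (real_complex _ x) : ring_scope.

(** * Lebesgue measurability versus Borel measurability *)

Section LebesgueBorel.
Context {R : realType}.
Notation mu := (@lebesgue_measure R).
Notation L := (lebesgueType R).

Lemma leb_lebesgue_measure (A : set R) : leb R A = mu A.
Proof. by []. Qed.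

Lemma borel_lebesgue_measurable (A : set R) :
  measurable A -> measurable (A : set L).
Proof. exact: sub_caratheodory. Qed.

(** The Lebesgue sigma-algebra is the completion of the Borel one. *)
Lemma lebesgue_measurable_split (A : set L) : measurable A ->
  exists B N : set R, [/\ measurable B, measurable N, mu N = 0%E &
    B `<=` A /\ A `<=` B `|` N].
Proof.
move=> mA.
have := mA; rewrite -[measurable A]/((@measurable _ L) A).
rewrite -completed_caratheodory_measurable g_sigma_completed_algebra_genE.
move=> [B mB [N [M [mM M0 NM]] <-]]; exists B, M; split => //.
by split; [exact: subsetUl|exact: setUS].
Qed.

Lemma negligible_leb (N : set R) :
  (leb R).-negligible N <-> mu.-negligible N.
Proof.
split; move=> [A [mA A0 NA]]; last first.
  by exists A; split => //; exact: borel_lebesgue_measurable.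
have [B [M [mB mM M0 [BA ABM]]]] := lebesgue_measurable_split mA.
exists (B `|` M); split; [exact: measurableU| |exact: subset_trans NA _].
apply/eqP; rewrite eq_le measure_ge0 andbT.
apply: (le_trans (measureU2 mu mB mM)).
change (mu B + mu M <= 0)%E; rewrite M0 adde0 -A0.
by rewrite -[mu B]/(leb R B) le_measure// inE//; exact: borel_lebesgue_measurable.
Qed.

Lemma ae_leb (P : R -> Prop) :
  {ae leb R, forall t, P t} <-> {ae mu, forall t, P t}.
Proof. exact: negligible_leb. Qed.

(** Each of the countably many sets [g > q], with [q] rational, is Borel up to a
    null Borel set. Outside the union [M] of these null sets, [g] is Borel. *)
Lemma borel_representative (g : L -> R) : measurable_fun setT g ->
  exists M : set R, [/\ measurable M, mu M = 0%E &
    measurable_fun setT (g \_ (~` M) : R -> R)].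
Proof.
move=> mg.
pose q n : R := ratr (odflt 0 (unpickle n : option rat)).
have E n : exists BN : set R * set R,
    [/\ measurable BN.1, measurable BN.2, mu BN.2 = 0%E &
    BN.1 `<=` g @^-1` `]q n, +oo[ /\ g @^-1` `]q n, +oo[ `<=` BN.1 `|` BN.2].
  have mA : measurable (g @^-1` `]q n, +oo[ : set L).
    by rewrite -[X in measurable X]setTI; apply: mg.
  have [B [N BN]] := lebesgue_measurable_split mA.
  by exists (B, N).
pose BN n := sval (cid (E n)).
have BNP n : [/\ measurable (BN n).1, measurable (BN n).2, mu (BN n).2 = 0%E &
    (BN n).1 `<=` g @^-1` `]q n, +oo[ /\
    g @^-1` `]q n, +oo[ `<=` (BN n).1 `|` (BN n).2] := svalP (cid (E n)).
pose M := \bigcup_n (BN n).2.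
have mM : measurable M.
  by apply: bigcupT_measurable => n; have [] := BNP n.
have M0 : mu M = 0%E.
  have : mu.-negligible M.
    apply: negligible_bigcup => n; have [_ mN N0 _] := BNP n.
    by exists (BN n).2; split.
  by move=> H; exact: (@measure_negligible _ (measurableTypeR R) R mu M mM H).
exists M; split => //.
apply: (measurability _ (RGenOInfty.measurableE R)) => // _ [_ [x ->] <-].
rewrite setTI.
have -> : (g \_ (~` M)) @^-1` `]x, +oo[ =
    (\bigcup_(n in [set n | x < q n]) ((BN n).1 `\` M)) `|`
    (M `&` [set _ | x < 0]).
  apply/seteqP; split => y /=; rewrite in_itv/= andbT patchE.
    case: ifPn => [|/negP yM xlt]; last first.
      right; split => //; apply: contrapT => My; apply: yM; exact/mem_set.
    rewrite inE/= => My xgy; left.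
    have [r] := rat_in_itvoo xgy; rewrite in_itv/= => /andP[xr rg].
    exists (pickle r); first by rewrite /= /q pickleK.
    split => //; have [_ _ _ [_ H]] := BNP (pickle r).
    have [//|N2] : ((BN (pickle r)).1 `|` (BN (pickle r)).2) y.
      by apply: H; rewrite /= in_itv/= andbT /q pickleK.
    by exfalso; apply: My; exists (pickle r).
  move=> [[n /= xq [By My]]|[My x0]].
    rewrite ifT ?inE//; have [_ _ _ [H _]] := BNP n.
    by have := H _ By; rewrite /= in_itv/= andbT; exact: lt_trans.
  by rewrite ifF//; apply/negP; rewrite inE/=; apply.
apply: measurableU.
  apply: bigcup_measurable => n _; apply: measurableD => //.
  by have [] := BNP n.
have [x0|x0] := pselect (x < 0).
  by rewrite (_ : [set _ | _] = setT) ?setIT//; apply/seteqP; split.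
by rewrite (_ : [set _ | _] = set0) ?setI0//; apply/seteqP; split.
Qed.

(** The restriction of the completed measure to Borel sets is its image under
    the identity map, so the formula for image measures applies. *)
Lemma integrable_leb_borel (D : set (measurableTypeR R)) (a : R -> R) :
  measurable D -> measurable_fun [set: measurableTypeR R] (a : measurableTypeR R -> R) ->
  mu.-integrable D (EFin \o a) <-> (leb R).-integrable D (EFin \o a).
Proof.
move=> mD ma; have mid : measurable_fun setT (idfun : L -> measurableTypeR R).
  by move=> _ B mB; rewrite setTI; exact: borel_lebesgue_measurable.
have maD : measurable_fun D (EFin \o a : measurableTypeR R -> \bar R).
  by apply/measurable_EFinP; exact: measurable_funS ma.
have maL : measurable_fun (D : set L) (EFin \o a : L -> \bar R).
  have maT : measurable_fun [set: L] (a : L -> R).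
    by move=> _ B mB; apply: borel_lebesgue_measurable; exact: ma.
  by apply/measurable_EFinP; exact: (@measurable_funS _ _ L R setT).
have E : (\int[leb R]_(x in D) `|(a x)%:E| = \int[mu]_(x in D) `|(a x)%:E|)%E.
  have mabs : measurable_fun D (fun x : measurableTypeR R => `|(a x)%:E|%E).
    exact: measurableT_comp.
  transitivity (\int[pushforward (leb R) (idfun : L -> measurableTypeR R)]_(x in D)
      `|(a x)%:E|)%E.
    by rewrite ge0_integral_pushforward.
  by apply: (eq_measure_integral mu) => A mA AD; rewrite /pushforward.
by split => /integrableP[_ H]; apply/integrableP; split => //;
  [rewrite E|rewrite -E].
Qed.

Lemma integral_leb_borel (D : set (measurableTypeR R)) (a : R -> R) :
  measurable D -> measurable_fun [set: measurableTypeR R] (a : measurableTypeR R -> R) ->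
  mu.-integrable D (EFin \o a) ->
  (\int[leb R]_(x in D) (a x)%:E = \int[mu]_(x in D) (a x)%:E)%E.
Proof.
move=> mD ma ia.
have mid : measurable_fun setT (idfun : L -> measurableTypeR R).
  by move=> _ B mB; rewrite setTI; exact: borel_lebesgue_measurable.
have maE : measurable_fun setT (EFin \o a : measurableTypeR R -> \bar R).
  exact/measurable_EFinP.
have ial := (integrable_leb_borel mD ma).1 ia.
rewrite -(@integral_pushforward _ _ _ _ R _ mid (leb R) D _ maE ial mD).
by apply: (eq_measure_integral mu) => A mA AD; rewrite /pushforward.
Qed.

End LebesgueBorel.

(** * Almost everywhere statements on the line and on the plane *)

Section AlmostEverywhere.
Context {R : realType}.
Notation mu := (@lebesgue_measure R).
Notation L := (lebesgueType R).

Lemma ae_leb_filter : Filter (almost_everywhere (leb R)).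
Proof. exact: (ae_filter_ringOfSetsType (leb R)). Qed.

Lemma ae_lebS (P Q : R -> Prop) : (forall t, P t -> Q t) ->
  {ae leb R, forall t : R, P t} -> {ae leb R, forall t : R, Q t}.
Proof. by move=> PQ; apply: (@filterS _ _ ae_leb_filter). Qed.

Lemma ae_lebI (P Q : R -> Prop) : {ae leb R, forall t : R, P t} ->
  {ae leb R, forall t : R, Q t} -> {ae leb R, forall t : R, P t /\ Q t}.
Proof. exact: (@filterI _ _ ae_leb_filter). Qed.

Lemma ae_leb_countable (X : Type) (D : set X) (P : X -> R -> Prop) :
  countable D -> (forall x, D x -> {ae leb R, forall t : R, P x t}) ->
  {ae leb R, forall t : R, forall x, D x -> P x t}.
Proof.
move=> /pfcard_geP[->|[g]] DP.
  by apply: (@filterE _ _ ae_leb_filter).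
have : {ae leb R, forall t : R, forall n, P (g n) t}.
  apply: ae_foralln => n; apply: DP; exact: funS.
apply: ae_lebS => t gt x /(@surj _ _ _ _ g)[n _ <-]; exact: gt.
Qed.

Lemma measurable_leb_itv (s t : R) : measurable (`[s, t] : set L).
Proof. by apply: borel_lebesgue_measurable; exact: measurable_itv. Qed.

Lemma ae_leb_neq (c : R) : {ae leb R, forall t : R, t != c}.
Proof.
apply/ae_leb; exists [set c]; split; first exact: measurable_set1.
  exact: lebesgue_measure_set1.
by move=> t /= /negP; rewrite negbK => /eqP.
Qed.

(** A set that misses a nondegenerate interval has a complement of positive
    measure. *)
Lemma ae_leb_exists (a b : R) (P : R -> Prop) : a < b ->
  {ae leb R, forall t : R, P t} -> exists2 t, a <= t <= b & P t.
Proof.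
move=> ab [N [mN N0 PN]]; apply: contrapT => nex.
have sub : `[a, b]%classic `<=` (N : set R).
  move=> t; rewrite /= in_itv/= => tab; apply: PN => /= Pt; apply: nex.
  by exists t.
have : (leb R `[a, b]%classic <= leb R N)%E.
  by apply: le_measure; rewrite ?inE//; exact: measurable_leb_itv.
have -> : leb R `[a, b]%classic = mu `[a, b]%classic by [].
by rewrite N0 lebesgue_measure_itv/= lte_fin ab -EFinB lee_fin leNgt subr_gt0 ab.
Qed.

Lemma ae_prod_section (P : R * R -> Prop) :
  {ae (leb R \x leb R)%E, forall st : R * R, P st} ->
  {ae leb R, forall s : R, {ae leb R, forall t : R, P (s, t)}}.
Proof.
move=> [N [mN N0 PN]].
pose sleb : {sigma_finite_measure set L -> \bar R} := @completed_lebesgue_measure R.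
have mx : measurable_fun [set: L] (leb R \o xsection N).
  exact: (@measurable_fun_xsection _ _ L L R sleb N mN).
have mxs (s : L) : measurable (xsection N s : set L) by exact: measurable_xsection.
have N0' : (\int[leb R]_x `|(leb R \o xsection N) x| = 0)%E.
  rewrite -[RHS]N0; apply: eq_integral => x _ /=.
  by rewrite gee0_abs// measure_ge0.
have := (@ae_eq_integral_abs _ L R (leb R) setT measurableT _ mx).1 N0'.
apply: ae_lebS => s /(_ I) /= Ns0.
exists (xsection N s : set L); split; [exact: (mxs s)|exact: Ns0|].
by move=> t /= nP; rewrite /xsection/= inE; apply: PN.
Qed.

(** By Fubini, for almost every [s] the equation holds for almost every [t]; any
    such [s] provides the constant. *)
Lemma ae_constant_prod (X : Type) (T : R) (q : R -> X) : 0 < T ->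
  {ae (leb R \x leb R)%E, forall st : R * R,
     0 <= st.1 <= T -> 0 <= st.2 <= T -> q st.2 = q st.1} ->
  exists c, {ae leb R, forall t : R, 0 <= t <= T -> q t = c}.
Proof.
move=> T0 /ae_prod_section /(ae_leb_exists T0)[s sT H].
by exists (q s); apply: ae_lebS H => t /= H tT; exact: H.
Qed.

Lemma ae_leb_near (T t d : R) (P : R -> Prop) : 0 < T -> 0 <= t <= T -> 0 < d ->
  {ae leb R, forall s : R, 0 <= s <= T -> P s} ->
  exists s, [/\ 0 <= s <= T, `|s - t| < d & P s].
Proof.
move=> T0 /andP[t0 tT] d0 aeP.
pose a := Num.max 0 (t - d / 2); pose b := Num.min T (t + d / 2).
have ab : a < b.
  by rewrite /a /b lt_min !gt_max; apply/andP; split; apply/andP; split; lra.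
have [s /andP[as_ sb] Ps] := ae_leb_exists ab aeP.
move: as_ sb; rewrite /a /b ge_max le_min => /andP[s0 ts] /andP[sT st].
exists s; split; [by rewrite s0| |by apply: Ps; rewrite s0].
by rewrite ltr_norml; apply/andP; split; lra.
Qed.

End AlmostEverywhere.

(** * Primitives of Lebesgue integrable functions *)

Section Primitive.
Context {R : realType}.
Notation mu := (@lebesgue_measure R).
Notation L := (lebesgueType R).
Notation B := (measurableTypeR R).

Definition primitive (a : R -> R) (t : R) : R := \int[leb R]_(r in `[0, t]) a r.

Definition lebint (T : R) (a : R -> R) :=
  (leb R).-integrable (`[0, T] : set L) (EFin \o a).

(** Through this lemma, what is known for Borel functions and Lebesgue measure
    (continuity and almost everywhere differentiability of primitives) carries
    over to Lebesgue measurable functions. *)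
Lemma lebint_borel (T : R) (a : R -> R) : lebint T a ->
  exists b : R -> R, [/\ measurable_fun [set: B] b,
    mu.-integrable [set: B] (EFin \o b),
    {ae leb R, forall t : R, 0 <= t <= T -> a t = b t} &
    forall s t, 0 <= s -> t <= T ->
      \int[leb R]_(r in `[s, t]) a r = \int[mu]_(r in `[s, t]) b r].
Proof.
move=> ia.
have m0T := measurable_leb_itv 0 T.
have ma : measurable_fun (`[0, T] : set L) (a : L -> R).
  by apply/measurable_EFinP; exact: measurable_int ia.
have ia' : (leb R).-integrable setT (EFin \o (a \_ `[0, T])).
  by rewrite -restrict_EFin; apply: ((integrable_mkcond _ m0T).1 ia).
have ma' : measurable_fun [set: L] (a \_ `[0, T]).
  by apply/measurable_EFinP; exact: measurable_int ia'.
have [M [mM M0 mb]] := borel_representative ma'.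
set b := (a \_ `[0, T]) \_ (~` M) in mb.
have mbL : measurable_fun [set: L] b.
  by move=> _ X mX; apply: borel_lebesgue_measurable; exact: mb.
have ibL : (leb R).-integrable [set: L] (EFin \o b).
  have mEb : measurable_fun [set: L] (EFin \o b) by exact/measurable_EFinP.
  apply: (@le_integrable _ L R (leb R) setT measurableT _ _ mEb _ ia').
  move=> x _; rewrite lee_fin /b !patchE/=.
  by case: ifP => // _; rewrite normr0.
have ab : {ae leb R, forall t : R, 0 <= t <= T -> a t = b t}.
  exists M; split => //; first exact: borel_lebesgue_measurable.
  move=> t /= /existsNP[tT nab]; apply: contrapT => Mt; apply: nab.
  by rewrite /b !patchE !mem_set.
have ibB : mu.-integrable [set: B] (EFin \o b) by apply/integrable_leb_borel.
exists b; split => // s t s0 tT.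
have st0T : `[s, t] `<=` `[0, T] by apply: subset_itvScc; rewrite bnd_simp.
rewrite /Rintegral; congr fine.
rewrite -integral_leb_borel//; last first.
  by apply: integrableS ibB => //; exact: measurable_itv.
apply: ae_eq_integral; [exact: measurable_leb_itv| | |].
- by apply/measurable_EFinP; exact: (@measurable_funS _ _ L R `[0, T]).
- by apply/measurable_EFinP; exact: (@measurable_funS _ _ L R setT).
- apply: ae_lebS ab => r abr rst /=; rewrite abr//.
  by have := st0T _ rst; rewrite /= in_itv.
Qed.

(** Continuity for the topology induced on the segment. The quantified form
    suits estimates between points of a set of full measure. *)
Definition eps_continuous (T : R) (F : R -> R) := forall t : R, 0 <= t <= T ->
  forall e : R, 0 < e -> exists2 d : R, 0 < d &
    forall s : R, 0 <= s <= T -> `|s - t| < d -> `|F s - F t| < e.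

Definition eps_derivable (T : R) (F : R -> R) (t l : R) := forall e : R, 0 < e ->
  exists2 d : R, 0 < d & forall h : R, h != 0 -> `|h| < d -> 0 <= t + h <= T ->
    `|h^-1 * (F (t + h) - F t) - l| < e.

Lemma primitive_itv (T : R) (a : R -> R) (s t : R) : lebint T a ->
  0 <= s -> s <= t -> t <= T ->
  \int[leb R]_(r in `[s, t]) a r = primitive a t - primitive a s.
Proof.
move=> ia s0 st tT.
have [b [mb ib _ E]] := lebint_borel ia.
have iS (X : set B) : measurable X -> mu.-integrable X (EFin \o b).
  by move=> mX; exact: (@integrableS _ B R mu setT).
rewrite /primitive E// E// E ?(le_trans st)//.
rewrite (@Rintegral_itvB _ b (BLeft 0) (BRight t)) ?bnd_simp//; last first.
  by apply: iS; exact: measurable_itv.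
by rewrite Rintegral_itv_obnd_cbnd//; apply: iS; exact: measurable_itv.
Qed.

Lemma primitive_within_continuous (T : R) (a : R -> R) : lebint T a -> 0 <= T ->
  {within `[0, T], continuous (primitive a)}.
Proof.
move=> ia T0.
have [b [mb ib _ E]] := lebint_borel ia.
have iS (X : set B) : measurable X -> mu.-integrable X (EFin \o b).
  by move=> mX; exact: (@integrableS _ B R mu setT).
have := @parameterized_integral_continuous R 0 T b T0
  (iS _ (measurable_itv _)).
apply: subspace_eq_continuous => t; rewrite inE/= in_itv/= => /andP[t0 tT].
by rewrite /from_subspace /parameterized_integral /primitive E.
Qed.

Lemma primitive_continuous (T : R) (a : R -> R) : lebint T a ->
  eps_continuous T (primitive a).
Proof.
move=> ia t /andP[t0 tT] e e0.
have := primitive_within_continuous ia (le_trans t0 tT).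
move=> /subspace_continuousP /(_ t); rewrite /= in_itv/= t0 tT => /(_ isT).
move=> /cvgrPdist_lt /(_ e e0) [d /= d0 H]; exists d => // s /andP[s0 sT] std.
have := H s; rewrite /ball_/= distrC in_itv/= s0 sT => /(_ std isT).
by rewrite distrC.
Qed.

Lemma primitive_derivable (T : R) (a : R -> R) : lebint T a ->
  {ae leb R, forall t : R, 0 < t < T -> eps_derivable T (primitive a) t (a t)}.
Proof.
move=> ia.
have [b [mb ib ab E]] := lebint_borel ia.
have iS (X : set B) : measurable X -> mu.-integrable X (EFin \o b).
  by move=> mX; exact: (@integrableS _ B R mu setT).
have lb : locally_integrable [set: R] b.
  by apply: open_integrable_locally => //; exact: openT.
have := (ae_leb _).2 (lebesgue_differentiation lb) => /(ae_lebI ab).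
apply: ae_lebS => t [abt lt] /andP[t0 tT] e e0.
have [] := @FTC1_lebesgue_pt R b (BLeft 0) t T tT (iS _ (measurable_itv _)) t0 lt.
rewrite derive1E; set F := fun y : R => _; rewrite /derivable /derive => dF dE.
rewrite dE in dF; move/cvgrPdist_lt : dF => /(_ e e0) [d /= d0 H].
exists d => // h hn0 hd /andP[th0 thT].
have := H h; rewrite /ball_/= sub0r normrN => /(_ hd hn0).
rewrite distrC /F /= [_ *: 1]mulr1 [h + t]addrC -abt ?(ltW t0) ?(ltW tT)//.
by rewrite /primitive !E// ltW.
Qed.

Lemma lebintS (T : R) (a : R -> R) (s t : R) : lebint T a -> 0 <= s -> t <= T ->
  (leb R).-integrable (`[s, t] : set L) (EFin \o a).
Proof.
move=> ia s0 tT; apply: (@integrableS _ L R (leb R) `[0, T]) => //;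
  try exact: measurable_leb_itv.
by apply: subset_itvScc; rewrite bnd_simp.
Qed.

Lemma lebint_cst (T c : R) : lebint T (fun=> c).
Proof.
have mT := measurable_leb_itv (0 : R) T.
have mc : measurable_fun (`[0, T] : set L) (cst c : L -> R) by exact: measurable_cst.
apply: (@measurable_bounded_integrable _ L R (leb R) (cst c) _ mT _ mc).
  have -> : leb R `[0, T]%classic = mu `[0, T]%classic by [].
  by rewrite lebesgue_measure_itv; case: ifP => // _; rewrite -EFinB ltry.
exists `|c|; split => // M cM x _ /=; exact: ltW.
Qed.

Lemma lebintD (T : R) (a b : R -> R) : lebint T a -> lebint T b ->
  lebint T (fun r => a r + b r).
Proof.
move=> ia ib; exact: (@integrableD _ L R (leb R) _ (measurable_leb_itv _ _) _ _ ia ib).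
Qed.

Lemma lebintZ (T c : R) (a : R -> R) : lebint T a -> lebint T (fun r => c * a r).
Proof.
move=> ia; exact: (@integrableZl _ L R (leb R) _ (measurable_leb_itv _ _) c _ ia).
Qed.

Lemma lebint_le (T : R) (a b : R -> R) :
  measurable_fun (`[0, T] : set L) (a : L -> R) -> lebint T b ->
  (forall t : R, 0 <= t <= T -> `|a t| <= b t) -> lebint T a.
Proof.
move=> ma ib ab.
have mEa : measurable_fun (`[0, T] : set L) (EFin \o a) by exact/measurable_EFinP.
apply: (@le_integrable _ L R (leb R) _ (measurable_leb_itv _ _) _ _ mEa _ ib) => t.
by rewrite /= in_itv/= => tT; rewrite lee_fin (le_trans (ab _ tT))// ler_norm.
Qed.

Lemma primitiveD (T : R) (a b : R -> R) t : lebint T a -> lebint T b -> t <= T ->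
  primitive (fun r => a r + b r) t = primitive a t + primitive b t.
Proof.
move=> ia ib tT.
exact: (@RintegralD _ L R (leb R) _ _ _ (measurable_leb_itv _ _)
  (lebintS ia (lexx 0) tT) (lebintS ib (lexx 0) tT)).
Qed.

Lemma primitiveZ (T c : R) (a : R -> R) t : lebint T a -> t <= T ->
  primitive (fun r => c * a r) t = c * primitive a t.
Proof.
move=> ia tT.
exact: (@RintegralZl _ L R (leb R) _ _ _ (measurable_leb_itv _ _)
  (lebintS ia (lexx 0) tT)).
Qed.

Lemma primitive_cst (c t : R) : 0 <= t -> primitive (fun=> c) t = c * t.
Proof.
move=> t0; rewrite /primitive (@Rintegral_cst _ L R (leb R) _ (measurable_leb_itv _ _)).
have -> : leb R `[0, t]%classic = mu `[0, t]%classic by [].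
rewrite lebesgue_measure_itv/= lte_fin; case: ifPn => [_|]; first by rewrite oppr0 addr0.
by rewrite -leNgt => t0'; have -> : t = 0 by apply/eqP; rewrite eq_le t0'.
Qed.

Lemma primitive0 (T : R) (a : R -> R) : 0 <= T -> lebint T a -> primitive a 0 = 0.
Proof. by move=> T0 ia; rewrite /primitive (primitive_itv ia)// subrr. Qed.

Lemma le_primitive (T : R) (a b : R -> R) (s t : R) : lebint T a -> lebint T b ->
  0 <= s -> s <= t -> t <= T -> 
  (forall r : R, s <= r <= t -> 0 <= b r) ->
  {ae leb R, forall r : R, s <= r <= t -> `|a r| <= b r} ->
  `|primitive a t - primitive a s| <= primitive b t - primitive b s.
Proof.
move=> ia ib s0 st tT b0 ab.
rewrite -(primitive_itv ia)// -(primitive_itv ib)//.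
have mst := measurable_leb_itv s t.
have iast := lebintS ia s0 tT; have ibst := lebintS ib s0 tT.
apply: (le_trans (@le_normr_Rintegral _ L R (leb R) _ _ mst iast)).
have iaast := @integrable_norm _ L R (leb R) _ _ iast.
rewrite -lee_fin /Rintegral.
rewrite fineK; last exact: (@integrable_fin_num _ L R (leb R) _ mst _ iaast).
rewrite fineK; last exact: (@integrable_fin_num _ L R (leb R) _ mst _ ibst).
have sub (r : R) : `[s, t]%classic r -> s <= r <= t by rewrite /= in_itv.
have a0 (r : L) : `[s, t]%classic r -> (0 <= `|a r|%:E)%E by rewrite lee_fin.
have bb0 (r : L) : `[s, t]%classic r -> (0 <= (b r)%:E)%E.
  by move=> /sub; rewrite lee_fin; exact: b0.
have ma : measurable_fun (`[s, t] : set L) (fun r : L => `|a r|%:E).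
  exact: measurable_int iaast.
have mb : measurable_fun (`[s, t] : set L) (fun r : L => (b r)%:E).
  exact: measurable_int ibst.
apply: (@ae_ge0_le_integral _ L R (leb R) _ mst _ _ a0 ma bb0 mb).
by apply: ae_lebS ab => r abr /sub rT; rewrite lee_fin abr.
Qed.

Lemma norm_primitive_le (T : R) (a b : R -> R) (s t : R) : lebint T a -> lebint T b ->
  0 <= s <= T -> 0 <= t <= T ->
  (forall r : R, 0 <= r <= T -> 0 <= b r) ->
  {ae leb R, forall r : R, 0 <= r <= T -> `|a r| <= b r} ->
  `|primitive a t - primitive a s| <= `|primitive b t - primitive b s|.
Proof.
move=> ia ib /andP[s0 sT] /andP[t0 tT] b0 ab.
have sub x y r : 0 <= x -> y <= T -> x <= r <= y -> 0 <= r <= T.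
  by move=> x0 yT /andP[xr ry]; rewrite (le_trans x0 xr) (le_trans ry yT).
have main x y : 0 <= x -> x <= y -> y <= T ->
    `|primitive a y - primitive a x| <= `|primitive b y - primitive b x|.
  move=> x0 xy yT; apply: le_trans (ler_norm _); apply: (le_primitive ia ib) => //.
    by move=> r /(sub _ _ _ x0 yT); exact: b0.
  by apply: ae_lebS ab => r abr /(sub _ _ _ x0 yT); exact: abr.
have [st|/ltW ts] := leP s t; first exact: main.
by rewrite distrC [leRHS]distrC; exact: main.
Qed.

Lemma primitive_nondecreasing (T : R) (b : R -> R) (s t : R) : lebint T b ->
  0 <= s -> s <= t -> t <= T -> (forall r : R, 0 <= r <= T -> 0 <= b r) ->
  primitive b s <= primitive b t.
Proof.
move=> ib s0 st tT b0; rewrite -subr_ge0.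
have b0' r : s <= r <= t -> 0 <= b r.
  by move=> /andP[sr rt]; rewrite b0// (le_trans s0 sr) (le_trans rt tT).
apply: le_trans (le_primitive ib ib s0 st tT b0' _) => //.
by apply: (@filterE _ _ ae_leb_filter) => r rT; rewrite ger0_norm// b0'.
Qed.

Lemma primitive_ge0 (b : R -> R) (T t : R) : 0 <= t <= T ->
  (forall r : R, 0 <= r <= T -> 0 <= b r) -> 0 <= primitive b t.
Proof.
move=> /andP[t0 tT] b0; apply: Rintegral_ge0 => r; rewrite /= in_itv/= => /andP[r0 rt].
by apply: b0; rewrite r0 (le_trans rt).
Qed.

(** Needed to add a primitive of [beta] to the function whose increments are
    studied, while keeping that function integrable. *)
Lemma lebint_primitive (T : R) (b : R -> R) : 0 <= T -> lebint T b ->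
  (forall r : R, 0 <= r <= T -> 0 <= b r) -> lebint T (primitive b).
Proof.
move=> T0 ib b0.
apply: (@lebint_le _ _ (fun=> primitive b T)) => [||t /andP[t0 tT]].
- have mB : measurable_fun (`[0, T] : set B) (primitive b).
    apply: subspace_continuous_measurable_fun; first exact: measurable_itv.
    exact: primitive_within_continuous.
  move=> mT X mX; apply: borel_lebesgue_measurable; apply: mB => //.
- exact: lebint_cst.
- rewrite ger0_norm; last by apply: (primitive_ge0 (T := T)); rewrite ?t0.
  exact: (primitive_nondecreasing ib).
Qed.

Lemma primitiveB (T : R) (a b : R -> R) t : lebint T a -> lebint T b -> t <= T ->
  primitive (fun r => a r - b r) t = primitive a t - primitive b t.
Proof.
move=> ia ib tT.
exact: (@RintegralB _ L R (leb R) _ _ _ (measurable_leb_itv _ _)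
  (lebintS ia (lexx 0) tT) (lebintS ib (lexx 0) tT)).
Qed.

Lemma lebint_ae_le (T : R) (a b : R -> R) :
  measurable_fun (`[0, T] : set L) (a : L -> R) -> lebint T b ->
  {ae leb R, forall t : R, 0 <= t <= T -> `|a t| <= b t} -> lebint T a.
Proof.
move=> ma ib ab; have mT := measurable_leb_itv (0 : R) T.
have mEa : measurable_fun (`[0, T] : set L) (EFin \o a) by exact/measurable_EFinP.
have mEb : measurable_fun (`[0, T] : set L) (EFin \o b) by exact: measurable_int ib.
have maa : measurable_fun (`[0, T] : set L) (fun t : L => `|(EFin \o a) t|%E).
  exact: (measurableT_comp (@abse_measurable R setT)).
have mbb : measurable_fun (`[0, T] : set L) (fun t : L => `|(EFin \o b) t|%E).
  exact: (measurableT_comp (@abse_measurable R setT)).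
apply/integrableP; split => //.
have /integrableP[_] := ib; apply: le_lt_trans.
apply: (@ae_ge0_le_integral _ L R (leb R) _ mT _ _ _ maa _ mbb).
- by move=> t _; exact: abse_ge0.
- by move=> t _; exact: abse_ge0.
- apply: ae_lebS ab => t abt; rewrite /= in_itv/= => tT.
  by rewrite lee_fin (le_trans (abt tT))// ler_norm.
Qed.

(** If [a] exceeded its mean plus [e / (hi - lo)] at every point of a set of full
    measure, its integral would be too large. *)
Lemma exists_le_mean (T lo hi e : R) (a : R -> R) (P : R -> Prop) :
  lebint T a -> (forall t : R, 0 <= t <= T -> 0 <= a t) ->
  {ae leb R, forall t : R, 0 <= t <= T -> P t} ->
  0 <= lo -> lo < hi -> hi <= T -> 0 < e ->
  exists r, [/\ lo <= r <= hi, P r &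
    a r * (hi - lo) <= primitive a hi - primitive a lo + e].
Proof.
move=> ia a0 aeP lo0 lohi hiT e0; apply: contrapT => nex.
have h0 : 0 < hi - lo by rewrite subr_gt0.
have sub r : lo <= r <= hi -> 0 <= r <= T.
  by move=> /andP[h1 h2]; rewrite (le_trans lo0 h1) (le_trans h2 hiT).
have D0 : 0 <= primitive a hi - primitive a lo.
  by rewrite subr_ge0; apply: (primitive_nondecreasing ia) => //; exact: ltW.
pose c := (primitive a hi - primitive a lo + e) / (hi - lo).
have c0 : 0 < c by rewrite divr_gt0// ltr_wpDl.
have := @le_primitive T (fun=> c) a lo hi (lebint_cst _ _) ia lo0 (ltW lohi) hiT.
have ca : {ae leb R, forall r : R, lo <= r <= hi -> `|c| <= a r}.
  apply: ae_lebS aeP => r Pr rI; rewrite (gtr0_norm c0) leNgt; apply/negP => ac.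
  apply: nex; exists r; split => //; first exact: Pr (sub _ rI).
  by rewrite -ler_pdivlMr// ltW.
move=> /(_ (fun r rI => a0 r (sub r rI)) ca).
rewrite !primitive_cst ?(le_trans lo0 (ltW lohi))// -mulrBr.
have cE : c * (hi - lo) = primitive a hi - primitive a lo + e.
  by rewrite /c divfK ?gt_eqF.
by rewrite cE => h; have := ler_norm (primitive a hi - primitive a lo + e); lra.
Qed.

End Primitive.

(** * Continuity and differentiability on the interval *)

Section EpsContinuous.
Context {R : realType}.

(** A set of full measure is dense. *)
Lemma eps_continuous_eq (T : R) (F G : R -> R) : 0 < T ->
  eps_continuous T F -> eps_continuous T G ->
  {ae leb R, forall t : R, 0 <= t <= T -> F t = G t} ->
  forall t : R, 0 <= t <= T -> F t = G t.
Proof.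
move=> T0 cF cG FG t tT; apply/eqP; apply: contrapT => /negP FGt.
have e0 : 0 < `|F t - G t| / 2 by rewrite divr_gt0// normr_gt0 subr_eq0.
have [d1 d10 H1] := cF t tT _ e0; have [d2 d20 H2] := cG t tT _ e0.
have d0 : 0 < Num.min d1 d2 by rewrite lt_min d10.
have [s [sT sd FGs]] := ae_leb_near T0 tT d0 FG.
move: sd; rewrite lt_min => /andP[/(H1 _ sT) + /(H2 _ sT)].
rewrite FGs distrC => h1 h2.
have := ler_normD (F t - G s) (G s - G t); rewrite addrA subrK; lra.
Qed.

Lemma eps_continuousZD (T c1 c2 : R) (F : R -> R) : eps_continuous T F ->
  eps_continuous T (fun t => c1 + c2 * F t).
Proof.
move=> cF t tT e e0.
have c0 : 0 < `|c2| + 1 by rewrite ltr_wpDl.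
have e1 : 0 < e / (`|c2| + 1) by rewrite divr_gt0.
have [d d0 H] := cF t tT _ e1; exists d => // s sT sd.
have -> : c1 + c2 * F s - (c1 + c2 * F t) = c2 * (F s - F t) by ring.
rewrite normrM; have := H s sT sd; rewrite ltr_pdivlMr// => h.
by have := normr_ge0 (F s - F t); nra.
Qed.

Lemma eps_continuous_sqr (T : R) (F : R -> R) : eps_continuous T F ->
  eps_continuous T (fun t => F t ^+ 2).
Proof.
move=> cF t tT e e0.
have b0 : 0 < 2 * `|F t| + 1 by rewrite ltr_wpDl// mulr_ge0.
have m0 : 0 < Num.min 1 (e / (2 * `|F t| + 1)) by rewrite lt_min ltr01 divr_gt0.
have [d d0 H] := cF t tT _ m0; exists d => // s sT sd.
have := H s sT sd; rewrite lt_min ltr_pdivlMr// => /andP[h1 h2].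
have -> : F s ^+ 2 - F t ^+ 2 = (F s - F t) * ((F s - F t) + 2 * F t) by ring.
rewrite normrM; have h3 := ler_normD (F s - F t) (2 * F t).
rewrite normrM (ger0_norm (ltW _)) // in h3.
have := normr_ge0 (F s - F t); nra.
Qed.

Lemma eq0_le_eps (a C : R) : (forall e : R, 0 < e -> `|a| <= C * e) -> a = 0.
Proof.
move=> H; apply/eqP; rewrite -normr_le0; apply/ler_addgt0Pl => e e0.
rewrite addr0; have C0 : 0 < `|C| + 1 by rewrite ltr_wpDl.
apply: le_trans (H (e / (`|C| + 1)) _) _; first by rewrite divr_gt0.
rewrite mulrA ler_pdivrMr// mulrC ler_wpM2l ?(ltW e0)//.
by rewrite (le_trans (ler_norm C))// lerDl.
Qed.

End EpsContinuous.

(** * Translations *)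

Section Translation.
Context {R : realType}.
Notation mu := (@lebesgue_measure R).
Notation L := (lebesgueType R).
Notation B := (measurableTypeR R).

Lemma lebesgue_measure_shift (h : R) (A : set B) : measurable A ->
  measurable ((fun r : R => r + h) @^-1` A : set B) /\
  mu ((fun r : R => r + h) @^-1` A) = mu A.
Proof.
move=> mA.
have ms : measurable_fun [set: B] ((fun r => r + h) : B -> B).
  apply: measurable_funD => //; exact: measurable_cst.
split; first by rewrite -[X in measurable X]setTI; exact: ms.
apply/esym.
apply: (@lebesgue_measure_unique R (pushforward mu ((fun r => r + h) : B -> B))) => //.
move=> _ [[x y] _ <-] /=; rewrite /pushforward /=.
have -> : (fun r => r + h) @^-1` `]x, y] = `]x - h, y - h]%classic.
  by apply/seteqP; split => r /=; rewrite !in_itv/= ltrBlDr lerBrDr.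
rewrite !lebesgue_measure_itv/= !lte_fin ltrD2r -!EFinB.
by case: ifP => // _; congr (_%:E); ring.
Qed.

(** A Lebesgue measurable set is a Borel set up to a part of a null Borel set,
    and translations preserve Borel sets and null sets. *)
Lemma measurable_shift (h : R) : measurable_fun [set: L] ((fun r => r + h) : L -> L).
Proof.
move=> _ A mA; rewrite setTI.
have [X [N [mX mN N0 [XA AXN]]]] := lebesgue_measurable_split mA.
have [mX' _] := lebesgue_measure_shift h mX.
have [mN' N0'] := lebesgue_measure_shift h mN.
have -> : (fun r : R => r + h) @^-1` A = (fun r => r + h) @^-1` X `|`
    ((fun r => r + h) @^-1` (A `\` X)).
  by rewrite -preimage_setU setDUK.
apply: measurableU; first exact: borel_lebesgue_measurable.
apply: (@completed_lebesgue_measure_is_complete R).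
exists ((fun r => r + h) @^-1` N); split.
- exact: borel_lebesgue_measurable.
- by rewrite -[LHS]/(mu _) N0'.
- move=> r [/= Ar Xr]; by have [] := AXN _ Ar.
Qed.

Lemma leb_shift (h : R) (A : set L) : measurable A ->
  leb R ((fun r : R => r + h) @^-1` A) = leb R A.
Proof.
move=> mA.
have [X [N [mX mN N0 [XA AXN]]]] := lebesgue_measurable_split mA.
have [mX' EX] := lebesgue_measure_shift h mX.
have [mN' EN] := lebesgue_measure_shift h mN.
have mA' : measurable ((fun r => r + h) @^-1` A : set L).
  by rewrite -[X in measurable X]setTI; exact: measurable_shift.
have E (C D M : set R) : measurable (C : set L) -> measurable (D : set B) ->
   measurable (M : set B) -> mu M = 0%E -> D `<=` C -> C `<=` D `|` M ->
   leb R C = mu D.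
  move=> mC mD mM M0 DC CDM; apply/eqP; rewrite eq_le; apply/andP; split.
    have DML : measurable (D `|` M : set L).
      by apply: measurableU; exact: borel_lebesgue_measurable.
    have : (leb R C <= mu (D `|` M))%E.
      by rewrite -[mu _]/(leb R (D `|` M)) le_measure// inE.
    move=> /le_trans; apply.
    by have := measureU2 mu mD mM; rewrite -[X in (_ <= X)%E]/(mu D + mu M)%E M0 adde0.
  by rewrite -[mu D]/(leb R D) le_measure// inE//; exact: borel_lebesgue_measurable.
rewrite (E _ _ _ mA mX mN N0 XA AXN) -EX.
apply: (E _ _ ((fun r => r + h) @^-1` N)) => //.
- by rewrite EN.
- by move=> r /= /XA.
- by move=> r /= /AXN.
Qed.

(** [a] is extended by zero outside the segment, so that the translated function
    is measurable on the whole line. *)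
Lemma integrable_shift (T h s t : R) (a : R -> R) : lebint T a ->
  0 <= s + h -> t + h <= T ->
  (leb R).-integrable (`[s, t] : set L) (fun r => (a (r + h))%:E) /\
  \int[leb R]_(r in `[s, t]) a (r + h) =
  \int[leb R]_(r in `[s + h, t + h]) a r.
Proof.
move=> ia sh th.
have m0T := measurable_leb_itv (0 : R) T.
have mst := measurable_leb_itv s t.
have mst' := measurable_leb_itv (s + h) (t + h).
pose a' := a \_ `[0, T].
have ia' : (leb R).-integrable setT (EFin \o a').
  by rewrite -restrict_EFin; apply: ((integrable_mkcond _ m0T).1 ia).
have ma' : measurable_fun [set: L] (EFin \o a') by exact: measurable_int ia'.
have pre : (fun r : R => r + h) @^-1` `[s + h, t + h] = `[s, t]%classic.
  by apply/seteqP; split => r /=; rewrite !in_itv/= !lerD2r.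
have sub r : `[s + h, t + h]%classic r -> `[0, T]%classic r.
  rewrite /= !in_itv/= => /andP[sr rt].
  by rewrite (le_trans sh sr) (le_trans rt th).
have aa' (r : R) : r \in (`[s, t]%classic : set L) -> (a' (r + h))%:E = (a (r + h))%:E.
  rewrite inE => rst; rewrite /a' patchE mem_set//; apply: sub.
  by move: rst; rewrite -pre.
have aa'' (r : R) : r \in (`[s + h, t + h]%classic : set L) -> (a' r)%:E = (a r)%:E.
  by rewrite inE => rst; rewrite /a' patchE mem_set//; exact: sub.
have msh := measurable_shift h.
have mc : measurable_fun [set: L] ((EFin \o a') \o (fun r : L => (r + h : L))).
  by move=> _ X mX; have := msh measurableT _ (ma' measurableT X mX); rewrite !setTI.
have ic : (leb R).-integrable [set: L] ((EFin \o a') \o (fun r : L => (r + h : L))).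
  apply/integrableP; split => //.
  have mabs : measurable_fun [set: L] (fun x : L => `|(EFin \o a') x|%E).
    exact: measurableT_comp.
  have := @ge0_integral_pushforward _ _ L L R _ msh (leb R) setT _ measurableT mabs.
  rewrite preimage_setT => <-//.
  case/integrableP : ia' => _; apply: le_lt_trans.
  rewrite le_eqVlt; apply/orP; left; apply/eqP.
  apply: (eq_measure_integral (leb R)) => A mA _.
  by exact: (leb_shift h mA).
have icst : (leb R).-integrable (`[s, t] : set L)
    ((EFin \o a') \o (fun r : L => (r + h : L))).
  exact: (@integrableS _ L R (leb R) setT).
split.
  by apply: (@eq_integrable _ L R (leb R) _ mst _ _ _ icst) => r rst /=; rewrite aa'.
rewrite /Rintegral; congr fine.
transitivity (\int[leb R]_(x in `[s, t]) (a' (x + h)%R)%:E)%E.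
  by apply: eq_integral => r rst /=; rewrite aa'.
rewrite -pre in icst *.
rewrite -(@integral_pushforward _ _ L L R _ msh (leb R) _ _ ma' icst mst').
transitivity (\int[leb R]_(x in `[(s + h)%R, (t + h)%R]) (a' x)%:E)%E.
  apply: (eq_measure_integral (leb R)) => A mA _; exact: (leb_shift h mA).
by apply: eq_integral => r rst /=; rewrite aa''.
Qed.

Lemma ae_leb_shift (h : R) (P : R -> Prop) : {ae leb R, forall t : R, P t} ->
  {ae leb R, forall t : R, P (t + h)}.
Proof.
move=> [N [mN N0 PN]]; exists ((fun r : R => r + h) @^-1` N); split.
- by rewrite -[X in measurable X]setTI; exact: measurable_shift.
- by rewrite leb_shift.
- by move=> r /= nP; apply: PN.
Qed.

End Translation.

(** * From difference quotients to increments *)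

Section Increment.
Context {R : realType}.
Notation L := (lebesgueType R).

Lemma le_limn_einf (u : (\bar R)^nat) (l : \bar R) (N : nat) :
  (forall n, (N <= n)%N -> (l <= u n)%E) -> (l <= limn_einf u)%E.
Proof.
move=> lu; rewrite limn_einf_lim (cvg_lim _ (@cvg_einfs_sup R u))//.
apply: (@le_trans _ _ (einfs u N)); last by apply: ereal_sup_ubound; exists N.
by apply: le_ereal_inf_tmp => _ [n /= Nn <-]; exact: lu.
Qed.

Lemma measurable_limn_einf d (X : measurableType d) (D : set X)
  (F : (X -> \bar R)^nat) : (forall n, measurable_fun D (F n)) ->
  measurable_fun D (fun x => limn_einf (F^~ x)).
Proof.
move=> mF; apply: (@emeasurable_fun_cvg _ _ _ _ (fun n x => einfs (F^~ x) n)).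
  by move=> n; exact: measurable_fun_einfs.
by move=> x _; rewrite limn_einf_lim; exact: is_cvg_einfs.
Qed.

(** The integral of a difference quotient from [a] to [b] telescopes: only
    difference quotients at the endpoints of a primitive remain. They converge
    to the values of the function at its Lebesgue points. *)
Lemma integral_quotient (T a b h : R) (Psi : R -> R) : lebint T Psi ->
  0 <= a -> a <= b -> b <= T -> 0 <= a + h -> b + h <= T ->
  (leb R).-integrable (`[a, b] : set L)
     (fun r => (h^-1 * (Psi (r + h) - Psi r))%:E) /\
  \int[leb R]_(r in `[a, b]) (h^-1 * (Psi (r + h) - Psi r)) =
  h^-1 * (primitive Psi (b + h) - primitive Psi b) -
  h^-1 * (primitive Psi (a + h) - primitive Psi a).
Proof.
move=> iP a0 ab bT ah bh.
have mab := measurable_leb_itv a b.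
have [ish Esh] := integrable_shift iP ah bh.
have iab := lebintS iP a0 bT.
have iB : (leb R).-integrable (`[a, b] : set L) (EFin \o (fun r => Psi (r + h) - Psi r)).
  exact: (@integrableB _ L R (leb R) _ mab _ _ ish iab).
split.
  exact: (@integrableZl _ L R (leb R) _ mab h^-1 _ iB).
rewrite (@RintegralZl _ L R (leb R) _ _ _ mab iB).
rewrite (@RintegralB _ L R (leb R) _ _ _ mab ish iab).
rewrite Esh !(primitive_itv iP) ?lerD2r //.
by ring.
Qed.

(** Fatou's lemma for the difference quotients of [Psi], which are bounded below
    by the integrable function [- alpha]. The limit of their integrals is given
    by [integral_quotient]; [Psi] may be discontinuous, and only [a] and [b] have
    to be Lebesgue points. *)
Lemma integral_le_increment (T a b : R) (Psi kappa alpha : R -> R) (h : nat -> R) :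
  lebint T Psi -> lebint T kappa -> lebint T alpha ->
  0 < a -> a <= b -> b < T ->
  (forall n, h n != 0) -> h @ \oo --> 0 ->
  eps_derivable T (primitive Psi) a (Psi a) ->
  eps_derivable T (primitive Psi) b (Psi b) ->
  {ae leb R, forall r : R, a <= r <= b -> forall n, 0 <= r + h n <= T ->
    - alpha r <= (h n)^-1 * (Psi (r + h n) - Psi r)} ->
  {ae leb R, forall r : R, a <= r <= b -> forall e : R, 0 < e ->
    \forall n \near \oo, kappa r - e <= (h n)^-1 * (Psi (r + h n) - Psi r)} ->
  \int[leb R]_(r in `[a, b]) kappa r <= Psi b - Psi a.
Proof.
move=> iP ik ia a0 ab bT hn0 h0 da db lo li.
have mab := measurable_leb_itv a b.
have T0 : 0 <= T by rewrite (le_trans (ltW a0))// (le_trans ab)// ltW.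
have [N hN] : exists N, forall n, (N <= n)%N -> `|h n| < Num.min a (T - b).
  have m0 : 0 < Num.min a (T - b) by rewrite lt_min a0 subr_gt0.
  have /cvgrPdist_lt/(_ _ m0)[N _ H] := h0.
  by exists N => n Nn; have := H n Nn; rewrite sub0r normrN.
pose h' n := h (n + N)%N.
have hlt n : `|h' n| < Num.min a (T - b) by apply: hN; exact: leq_addl.
have h'0 : h' @ \oo --> 0 by rewrite /h' (cvg_shiftn N).
have ah n : 0 <= a + h' n.
  have := hlt n; rewrite lt_min => /andP[+ _]; rewrite ltr_norml => /andP[+ _].
  by move=> ?; lra.
have bh n : b + h' n <= T.
  have := hlt n; rewrite lt_min => /andP[_]; rewrite ltr_norml => /andP[_ +].
  by move=> ?; lra.
pose D n r := (h' n)^-1 * (Psi (r + h' n) - Psi r).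
pose c n := (h' n)^-1 * (primitive Psi (b + h' n) - primitive Psi b) -
            (h' n)^-1 * (primitive Psi (a + h' n) - primitive Psi a).
have iD n := integral_quotient iP (ltW a0) ab (ltW bT) (ah n) (bh n).
have quot_cvg x : a <= x <= b -> eps_derivable T (primitive Psi) x (Psi x) ->
    (h' n)^-1 * (primitive Psi (x + h' n) - primitive Psi x) @[n --> \oo] --> Psi x.
  move=> /andP[ax xb] dx; apply/cvgrPdist_lt => e e0.
  have [d d0 H] := dx e e0.
  have /cvgrPdist_lt/(_ _ d0)[M _ HM] := h'0.
  exists M => // n Mn; have := HM n Mn; rewrite sub0r normrN => hd.
  rewrite distrC; apply: H => //; first exact: hn0.
  by rewrite (le_trans (ah n)) ?lerD2r// (le_trans _ (bh n)) ?lerD2r.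
have cc : c n @[n --> \oo] --> Psi b - Psi a.
  by apply: cvgB; apply: quot_cvg => //; rewrite ?lexx ?ab.
have ikab := lebintS ik (ltW a0) (ltW bT).
have iaab := lebintS ia (ltW a0) (ltW bT).
pose F n r := Num.max 0 (D n r + alpha r).
have iDa n : (leb R).-integrable (`[a, b] : set L) (EFin \o (fun r => D n r + alpha r)).
  exact: (@integrableD _ L R (leb R) _ mab _ _ (iD n).1 iaab).
have mF n : measurable_fun (`[a, b] : set L) (F n).
  apply: measurable_maxr; first exact: measurable_cst.
  by apply/measurable_EFinP; exact: measurable_int (iDa n).
have EF n : (\int[leb R]_(r in `[a, b]) (F n r)%:E =
    (c n + \int[leb R]_(r in `[a, b]) alpha r)%:E)%E.
  rewrite /c -(iD n).2 -(@RintegralD _ L R (leb R) _ _ _ mab (iD n).1 iaab).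
  rewrite /Rintegral fineK; last exact: (@integrable_fin_num _ L R (leb R) _ mab _ (iDa n)).
  have mEFn : measurable_fun (`[a, b] : set L) (EFin \o F n) by exact/measurable_EFinP.
  have mDa : measurable_fun (`[a, b] : set L) (EFin \o (fun r => D n r + alpha r)).
    exact: measurable_int (iDa n).
  apply: (@ae_eq_integral _ L R (leb R) _ _ _ mab mEFn mDa).
  apply: ae_lebS lo => r lor rab; congr EFin; rewrite /F.
  apply/max_idPr; rewrite -lerBlDr sub0r; apply: lor => //.
  move: rab; rewrite /= in_itv/= => /andP[ar rb].
  by rewrite (le_trans (ah n)) ?lerD2r// (le_trans _ (bh n)) ?lerD2r.
have ika : (leb R).-integrable (`[a, b] : set L) (EFin \o (fun r => kappa r + alpha r)).
  exact: (@integrableD _ L R (leb R) _ mab _ _ ikab iaab).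
rewrite -(lerD2r (\int[leb R]_(r in `[a, b]) alpha r)).
rewrite -(@RintegralD _ L R (leb R) _ _ _ mab ikab iaab) -lee_fin.
rewrite /Rintegral fineK; last exact: (@integrable_fin_num _ L R (leb R) _ mab _ ika).
have -> : ((Psi b - Psi a + fine (\int[leb R]_(x in `[a, b]) (alpha x)%:E)%E)%:E =
   limn_einf (fun n => \int[leb R]_(r in `[a, b]) (F n r)%:E))%E.
  apply/esym/(cvg_limn_einf_sup _).1.
  under eq_fun do rewrite EF.
  apply: cvg_EFin; first by apply: nearW.
  by apply: cvgD => //; exact: cvg_cst.
have mEF n : measurable_fun (`[a, b] : set L) (EFin \o F n) by exact/measurable_EFinP.
have F0 n (x : L) : `[a, b]%classic x -> (0 <= (EFin \o F n) x)%E.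
  by move=> _; rewrite lee_fin /F le_max lexx.
apply: le_trans (@fatou _ L R (leb R) _ mab (fun n => EFin \o F n) mEF F0).
pose G r := Num.max 0 (kappa r + alpha r).
have mG : measurable_fun (`[a, b] : set L) (EFin \o G).
  apply/measurable_EFinP/measurable_maxr; first exact: measurable_cst.
  by apply/measurable_EFinP; exact: measurable_int ika.
have iG : (leb R).-integrable (`[a, b] : set L) (EFin \o G).
  apply: (@le_integrable _ L R (leb R) _ mab _ _ mG _ ika) => r _.
  rewrite lee_fin /G; case: (lerP 0 (kappa r + alpha r)) => // _.
  by rewrite normr0.
apply: (@le_trans _ _ (\int[leb R]_(r in `[a, b]) (G r)%:E)%E).
  apply: (@le_integral _ L R (leb R) _ mab) => // r _.
  by rewrite lee_fin le_max lexx orbT.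
have G0 (r : L) : `[a, b]%classic r -> (0 <= (EFin \o G) r)%E.
  by move=> _; rewrite lee_fin le_max lexx.
have l0 (r : L) : `[a, b]%classic r ->
    (0 <= limn_einf (fun n => (EFin \o F n) r))%E.
  by move=> rab; apply: (@le_limn_einf _ _ 0) => n _; exact: F0.
have ml : measurable_fun (`[a, b] : set L)
    (fun r => limn_einf (fun n => (EFin \o F n) r)).
  exact: measurable_limn_einf.
apply: (@ae_ge0_le_integral _ L R (leb R) _ mab _ _ G0 mG l0 ml).
apply: ae_lebS li => r lir; rewrite /= in_itv => rab.
  apply/lee_addgt0Pr => e e0; rewrite -leeBlDr//.
  have [M _ HM] := lir rab e e0.
  apply: (@le_limn_einf _ _ M) => n Mn /=.
  rewrite -EFinB lee_fin.
  have := HM (n + N)%N (leq_trans Mn (leq_addr _ _)).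
  rewrite -/(h' n) -/(D n r) /F /G => H.
  have [_|p0] := lerP 0 (kappa r + alpha r).
    by rewrite le_max; apply/orP; right; lra.
  by rewrite le_max; apply/orP; left; lra.
Qed.

Lemma cvg_signed_harmonic (sg : R) : (sg * n.+1%:R^-1) @[n --> \oo] --> (0 : R).
Proof.
rewrite -[X in _ --> X](mulr0 sg); apply: cvgM; first exact: cvg_cst.
exact: cvg_harmonic.
Qed.

(** Here [A r] is a primitive of [q |-> <v*_q, v r>], so that [k r] is the
    derivative of [A r] at [r]. The lower bound for [phi s - phi r] yields a
    lower bound for the difference quotients when [s > r] and an upper bound when
    [s < r]; the sign [sg] of the step [h] distinguishes these two cases. The
    inequality is obtained from [integral_le_increment] applied to
    [sg * phi + 2 * B], where [B] is the primitive of [beta]. *)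
Lemma one_sided_energy (T sg : R) (phi k alpha beta : R -> R) (A : R -> R -> R) (S : set R) :
  0 < T -> sg = 1 \/ sg = -1 ->
  lebint T phi -> lebint T k -> lebint T alpha -> lebint T beta ->
  (forall t : R, 0 <= t <= T -> 0 <= beta t) ->
  {ae leb R, forall t : R, 0 <= t <= T -> S t} ->
  (forall r s, S r -> S s -> 0 <= r <= T -> 0 <= s <= T ->
     2 * (A r s - A r r) <= phi s - phi r) ->
  (forall r s, S r -> 0 <= r <= T -> 0 <= s <= T ->
     `|A r s - A r r| <= alpha r * `|s - r| + `|primitive beta s - primitive beta r|) ->
  (forall r, S r -> 0 < r < T -> eps_derivable T (A r) r (k r)) ->
  {ae leb R, forall a : R, 0 < a < T -> forall b : R, 0 < b < T ->
     eps_derivable T (primitive (fun r => sg * phi r + 2 * primitive beta r)) b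
       (sg * phi b + 2 * primitive beta b) -> a <= b ->
     2 * sg * (primitive k b - primitive k a) <= sg * (phi b - phi a)}.
Proof.
move=> T0 sg1 ip ik ia ib b0 aeS lo bd dA.
have sg2 : sg * sg = 1 by case: sg1 => ->; rewrite ?mulr1// mulrNN mulr1.
have sgn : `|sg| = 1 by case: sg1 => ->; rewrite ?normrN normr1.
pose Bt := primitive beta.
pose Psi r := sg * phi r + 2 * Bt r.
pose kap r := 2 * sg * k r + 2 * beta r.
pose al r := 2 * alpha r.
have iP : lebint T Psi.
  by apply: lebintD; apply: lebintZ => //; apply: lebint_primitive => //; exact: ltW.
have ikap : lebint T kap by apply: lebintD; exact: lebintZ.
have ial : lebint T al by exact: lebintZ.
pose h n : R := sg * n.+1%:R^-1.
have sgn0 : sg != 0 by rewrite -normr_eq0 sgn oner_eq0.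
have hn0 n : h n != 0 by rewrite mulf_neq0// invr_eq0 pnatr_eq0.
have h0 : h @ \oo --> 0 by exact: cvg_signed_harmonic.
have hV n : (h n)^-1 = sg * `|h n|^-1.
  rewrite /h normrM sgn mul1r ger0_norm ?invr_ge0// invrK invfM invrK.
  by congr (_ * _); case: sg1 => ->; rewrite ?invr1// invrN invr1.
have aeSh : {ae leb R, forall r : R, 0 <= r <= T ->
    S r /\ forall n, 0 <= r + h n <= T -> S (r + h n)}.
  have : {ae leb R, forall r : R, forall n, 0 <= r + h n <= T -> S (r + h n)}.
    by apply: ae_foralln => n; exact: (ae_leb_shift (h n) aeS).
  by move=> /(ae_lebI aeS); apply: ae_lebS => r [Sr Srh] rT; split => //; exact: Sr.
have quot r n : S r -> S (r + h n) -> 0 <= r <= T -> 0 <= r + h n <= T ->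
   2 * sg * ((h n)^-1 * (A r (r + h n) - A r r)) +
     2 * ((h n)^-1 * (Bt (r + h n) - Bt r)) <=
   (h n)^-1 * (Psi (r + h n) - Psi r) /\
   - al r <= (h n)^-1 * (Psi (r + h n) - Psi r).
  move=> Sr Srh rT rhT.
  (* Since beta is nonnegative, sg times the increment of its primitive is the
     absolute value of that increment: this is what compensates the mean of
     beta, for both signs of h. *)
  have sB : sg * (Bt (r + h n) - Bt r) = `|Bt (r + h n) - Bt r|.
    have n0 : 0 <= (n.+1%:R^-1 : R) by rewrite invr_ge0.
    move: rT rhT => /andP[r0 rT] /andP[rh0 rhT].
    case: sg1 => sgE; rewrite sgE.
      rewrite mul1r ger0_norm// subr_ge0.
      apply: (primitive_nondecreasing ib) => //.
      by rewrite lerDl /h sgE mul1r.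
    rewrite mulN1r ler0_norm// subr_le0.
    apply: (primitive_nondecreasing ib) => //.
    by rewrite gerDl /h sgE mulN1r oppr_le0.
  have q0 : 0 < `|h n|^-1 by rewrite invr_gt0 normr_gt0.
  have qh : `|h n|^-1 * `|h n| = 1 by rewrite mulVf// normr_eq0.
  have lo1 := lo _ _ Sr Srh rT rhT.
  have := bd _ _ Sr rT rhT; rewrite -/Bt [r + h n - r]addrC addKr => bd1.
  have hq : (h n)^-1 * (Psi (r + h n) - Psi r) =
      `|h n|^-1 * ((phi (r + h n) - phi r) + 2 * (sg * (Bt (r + h n) - Bt r))).
    by rewrite hV /Psi; case: sg1 => ->; ring.
  have hA : 2 * sg * ((h n)^-1 * (A r (r + h n) - A r r)) +
      2 * ((h n)^-1 * (Bt (r + h n) - Bt r)) =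
      `|h n|^-1 * (2 * (A r (r + h n) - A r r) + 2 * (sg * (Bt (r + h n) - Bt r))).
    by rewrite hV; case: sg1 => ->; ring.
  split; first by rewrite hq hA ler_wpM2l ?(ltW q0)// lerD2r.
  rewrite hq sB; move: bd1; rewrite ler_norml => /andP[bd1 _].
  have -> : - al r = `|h n|^-1 * (- 2 * (alpha r * `|h n|)).
    by rewrite /al -[alpha r in LHS]mulr1 -qh; ring.
  rewrite ler_wpM2l ?(ltW q0)//; lra.
have aeP := primitive_derivable iP.
apply: ae_lebS aeP => a da a0T b b0T db ab.
have [a0 aT] := andP a0T; have [b0' bT] := andP b0T.
have sub r : a <= r <= b -> 0 <= r <= T /\ 0 < r < T.
  move=> /andP[ar rb]; have r0 := lt_le_trans a0 ar; have rT := le_lt_trans rb bT.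
  by rewrite r0 rT !ltW.
have := @integral_le_increment T a b Psi kap al h iP ikap ial a0 ab bT hn0 h0 (da a0T) db.
have Ekap t : t <= T -> primitive kap t = 2 * sg * primitive k t + 2 * Bt t.
  move=> tT; rewrite (primitiveD (lebintZ _ ik) (lebintZ _ ib) tT).
  by rewrite (primitiveZ _ ik tT) (primitiveZ _ ib tT).
rewrite (primitive_itv ikap) ?(ltW a0) ?(ltW bT)// !Ekap ?(ltW aT) ?(ltW bT)//.
rewrite /Psi -/Bt => H.
suff : 2 * sg * primitive k b + 2 * Bt b - (2 * sg * primitive k a + 2 * Bt a) <=
    sg * phi b + 2 * Bt b - (sg * phi a + 2 * Bt a) by move=> ?; lra.
apply: H.
- apply: ae_lebS aeSh => r Hr /sub [rT _] n rhT.
  have [Sr Srh] := Hr rT.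
  exact: (quot r n Sr (Srh _ rhT) rT rhT).2.
- apply: ae_lebS (ae_lebI aeSh (primitive_derivable ib)) => r [Hr dB] /sub [rT r0T] e e0.
  have [Sr Srh] := Hr rT.
  have c2 : 2 * sg * ((h n)^-1 * (A r (r + h n) - A r r)) +
     2 * ((h n)^-1 * (Bt (r + h n) - Bt r)) @[n --> \oo] --> kap r.
    have quot_cvg F l : eps_derivable T F r l ->
        (h n)^-1 * (F (r + h n) - F r) @[n --> \oo] --> l.
      move=> dF; apply/cvgrPdist_lt => e1 e10.
      have [d d0 HF] := dF _ e10.
      have m0 : 0 < Num.min d (Num.min r (T - r)).
        by case/andP: r0T => r0 rT'; rewrite !lt_min d0 r0 subr_gt0.
      have /cvgrPdist_lt/(_ _ m0)[M _ HM] := h0.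
      exists M => // n Mn; have := HM n Mn; rewrite sub0r normrN !lt_min.
      move=> /and3P[hd hr hT]; rewrite distrC; apply: HF => //.
      by move: hr hT; rewrite !ltr_norml => /andP[? ?] /andP[? ?]; apply/andP; split; lra.
    apply: cvgD; apply: cvgM; try exact: cvg_cst.
      by apply: quot_cvg; exact: dA.
    by apply: quot_cvg; exact: dB.
  have m0 : 0 < Num.min r (T - r).
    by case/andP: r0T => r0 rT'; rewrite !lt_min r0 subr_gt0.
  move/cvgrPdist_lt : c2 => /(_ _ e0) c2.
  move/cvgrPdist_lt : h0 => /(_ _ m0) h0.
  near=> n.
  have rhT : 0 <= r + h n <= T.
    have : `|0 - h n| < Num.min r (T - r) by near: n; exact: h0.
    rewrite sub0r normrN lt_min !ltr_norml => /andP[/andP[? ?] /andP[? ?]].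
    by apply/andP; split; lra.
  apply: le_trans (quot r n Sr (Srh _ rhT) rT rhT).1.
  have : `|kap r - (2 * sg * ((h n)^-1 * (A r (r + h n) - A r r)) +
     2 * ((h n)^-1 * (Bt (r + h n) - Bt r)))| < e by near: n; exact: c2.
  by rewrite ltr_norml => /andP[_ ?]; lra.
Unshelve. all: by end_near. Qed.

(** The two signs of the step give the two inequalities. *)
Lemma energy_identity (T : R) (phi k alpha beta : R -> R) (A : R -> R -> R) (S : set R) :
  0 < T ->
  lebint T phi -> lebint T k -> lebint T alpha -> lebint T beta ->
  (forall t : R, 0 <= t <= T -> 0 <= beta t) ->
  {ae leb R, forall t : R, 0 <= t <= T -> S t} ->
  (forall r s, S r -> S s -> 0 <= r <= T -> 0 <= s <= T ->
     2 * (A r s - A r r) <= phi s - phi r) ->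
  (forall r s, S r -> 0 <= r <= T -> 0 <= s <= T ->
     `|A r s - A r r| <= alpha r * `|s - r| + `|primitive beta s - primitive beta r|) ->
  (forall r, S r -> 0 < r < T -> eps_derivable T (A r) r (k r)) ->
  exists2 G : set R, {ae leb R, forall t : R, 0 <= t <= T -> G t} &
    forall a b, G a -> G b -> phi b - phi a = 2 * (primitive k b - primitive k a).
Proof.
move=> T0 ip ik ia ib b0 aeS lo bd dA.
have E sg (sg1 : sg = 1 \/ sg = -1) :=
  @one_sided_energy T sg phi k alpha beta A S T0 sg1 ip ik ia ib b0 aeS lo bd dA.
pose Psi sg r := sg * phi r + 2 * primitive beta r.
have dP sg : {ae leb R, forall t : R, 0 < t < T ->
    eps_derivable T (primitive (Psi sg)) t (Psi sg t)}.
  apply: primitive_derivable; apply: lebintD; apply: lebintZ => //.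
  by apply: lebint_primitive => //; exact: ltW.
pose Q sg a := forall b : R, 0 < b < T -> eps_derivable T (primitive (Psi sg)) b (Psi sg b) ->
  a <= b -> 2 * sg * (primitive k b - primitive k a) <= sg * (phi b - phi a).
pose D sg t := eps_derivable T (primitive (Psi sg)) t (Psi sg t).
exists (fun t => [/\ 0 < t < T, D 1 t /\ D (-1) t & Q 1 t /\ Q (-1) t]).
  have := ae_lebI (ae_lebI (dP 1) (dP (-1)))
    (ae_lebI (ae_lebI (E 1 (or_introl erefl)) (E (-1) (or_intror erefl)))
       (ae_lebI (ae_leb_neq 0) (ae_leb_neq T))).
  apply: ae_lebS => t [[d1 d2] [[q1 q2] [n0 nT]]] /andP[t0 tT].
  have t0T : 0 < t < T by rewrite !lt_neqAle eq_sym n0 nT t0 tT.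
  split=> //; first by split; [exact: d1|exact: d2].
  by split; [exact: q1|exact: q2].
have sym a b : 0 < b < T -> D 1 b /\ D (-1) b -> Q 1 a /\ Q (-1) a -> a <= b ->
    phi b - phi a = 2 * (primitive k b - primitive k a).
  move=> bT [d1 d2] [q1 q2] ab; have := q1 b bT d1 ab; have := q2 b bT d2 ab.
  by move=> H1 H2; apply/eqP; rewrite eq_le; apply/andP; split; lra.
move=> a b [aT da qa] [bT db qb]; have [ab|/ltW ba] := leP a b.
  exact: sym.
by have := sym b a aT da qb ba; lra.
Qed.

End Increment.

(** * Norms with real values and the real inner product *)

Section Rnorm.
Context {R : realType} {V : normedModType R[i]}.
Implicit Types x y z : V.

Lemma rnormE x : `|x| = (rnorm x)%:C.
Proof. by rewrite /rnorm [LHS]complexE (ger0_Im (normr_ge0 x)) mulr0 addr0. Qed.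

Lemma rnorm_ge0 x : 0 <= rnorm x.
Proof. by rewrite -ler0c -rnormE. Qed.

Lemma ler_rnormD x y : rnorm (x + y) <= rnorm x + rnorm y.
Proof. by rewrite -lecR rmorphD/= -!rnormE ler_normD. Qed.

Lemma rnormN x : rnorm (- x) = rnorm x.
Proof. by rewrite /rnorm normrN. Qed.

Lemma rnormBC x y : rnorm (x - y) = rnorm (y - x).
Proof. by rewrite -rnormN opprB. Qed.

Lemma rnormZ (c : R) x : rnorm (c%:C *: x) = `|c| * rnorm x.
Proof.
apply: (@complexI R); rewrite rmorphM/= -!rnormE normrZ normc_def/=.
by rewrite expr0n addr0 sqrtr_sqr.
Qed.

Lemma rnorm0 : rnorm (0 : V) = 0.
Proof. by rewrite /rnorm normr0. Qed.

Lemma ler_rnormB x y : `|rnorm x - rnorm y| <= rnorm (x - y).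
Proof.
have H (u w : V) : rnorm u - rnorm w <= rnorm (u - w).
  by have := ler_rnormD (u - w) w; rewrite subrK lerBlDr.
by rewrite ler_norml H andbT lerNl opprB rnormBC H.
Qed.

(** A positive element of [R[i]] is a positive real number, so balls with real
    radii suffice. *)
Lemma rnorm_cvgP (F : set_system V) (FF : Filter F) (l : V) :
  F --> l <-> forall e : R, 0 < e -> \forall x \near F, rnorm (l - x) < e.
Proof.
split=> [/cvgrPdist_lt Fl e e0|Fl].
  have : 0 < e%:C :> R[i] by rewrite ltcR.
  by move=> /Fl; apply: filterS => x; rewrite rnormE ltcR.
apply/cvgrPdist_lt => e; rewrite ltcE/= => /andP[/eqP Ie Re0].
apply: filterS (Fl _ Re0) => x xe.
by rewrite rnormE ltcE/= Ie eqxx.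
Qed.

End Rnorm.

Lemma Re_le_rnorm {R : realType} (z : R[i]) : `|complex.Re z| <= rnorm z.
Proof.
rewrite /rnorm normc_def/= -sqrtr_sqr; apply: ler_wsqrtr.
by rewrite lerDl sqr_ge0.
Qed.

Lemma Re_conjC {R : realType} (z : R[i]) : complex.Re (Num.conj z) = complex.Re z.
Proof. by case: z. Qed.

Lemma ReD {R : realType} (z w : R[i]) : complex.Re (z + w) = complex.Re z + complex.Re w.
Proof. by case: z; case: w. Qed.

Lemma ReN {R : realType} (z : R[i]) : complex.Re (- z) = - complex.Re z.
Proof. by case: z. Qed.

Lemma Re_realM {R : realType} (c : R) (z : R[i]) : complex.Re (c%:C * z) = c * complex.Re z.
Proof. by case: z => a b /=; rewrite mul0r subr0. Qed.

Section RealInner.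
Context {R : realType} {H : normedModType R[i]}.
Variable ip : {dot H for @Num.conj R[i]}.
Hypothesis ipH : inner_product_norm ip.
Implicit Types x y z : H.

Definition rip x y : R := complex.Re (ip x y).

Lemma ripC x y : rip x y = rip y x.
Proof.
by rewrite /rip hermC expr0 mul1r; exact: Re_conjC.
Qed.

Lemma ripDl x y z : rip (x + y) z = rip x z + rip y z.
Proof. by rewrite /rip linearDl; exact: ReD. Qed.

Lemma ripNl x z : rip (- x) z = - rip x z.
Proof. by rewrite /rip linearNl; exact: ReN. Qed.

Lemma ripBl x y z : rip (x - y) z = rip x z - rip y z.
Proof. by rewrite ripDl ripNl. Qed.

Lemma ripBr x y z : rip z (x - y) = rip z x - rip z y.
Proof. by rewrite ripC ripBl !(ripC z). Qed.

Lemma ripZl (c : R) x y : rip (c%:C *: x) y = c * rip x y.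
Proof.
by rewrite /rip linearZl_LR; exact: Re_realM.
Qed.

Lemma ripxx x : rip x x = rnorm x ^+ 2.
Proof. by rewrite /rip -ipH rnormE -rmorphXn. Qed.

Lemma rnorm2B x y : rnorm (x - y) ^+ 2 = rnorm x ^+ 2 + rnorm y ^+ 2 - 2 * rip x y.
Proof.
rewrite -!ripxx ripBl !ripBr (ripC y x); ring.
Qed.

(** The identity from which both the energy equality and the continuity follow:
    the last term is dropped for the former and estimated for the latter. *)
Lemma rip_increment x y :
  rnorm x ^+ 2 - rnorm y ^+ 2 = 2 * rip (x - y) y + rnorm (x - y) ^+ 2.
Proof. by rewrite rnorm2B ripBl ripxx; ring. Qed.

(** Cauchy-Schwarz, from the positivity of the squared norm of
    [|w| u - |u| w]. *)
Lemma ler_rip x y : `|rip x y| <= rnorm x * rnorm y.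
Proof.
have CS u w : rip u w <= rnorm u * rnorm w.
  have [u0|un0] := eqVneq (rnorm u) 0.
    have -> : u = 0 by apply/eqP; rewrite -normr_eq0 rnormE u0.
    by rewrite /rip linear0l mulr_ge0 ?rnorm_ge0.
  have [w0|wn0] := eqVneq (rnorm w) 0.
    have -> : w = 0 by apply/eqP; rewrite -normr_eq0 rnormE w0.
    by rewrite ripC /rip linear0l mulr_ge0 ?rnorm_ge0.
  have up : 0 < rnorm u * rnorm w by rewrite mulr_gt0// lt_def ?un0 ?wn0 rnorm_ge0.
  have := sqr_ge0 (rnorm ((rnorm w)%:C *: u - (rnorm u)%:C *: w)).
  rewrite rnorm2B !rnormZ ripZl ripC ripZl ripC !ger0_norm ?rnorm_ge0// => h.
  rewrite -(ler_pM2l up); nra.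
rewrite ler_norml CS andbT lerNl -ripNl.
by rewrite (le_trans (CS _ _))// rnormN.
Qed.

End RealInner.

(** * Extension by continuity of functions with values in a complete normed space *)

Section Extension.
Context {R : realType} {H : completeNormedModType R[i]}.

Definition eps_continuous_vec (T : R) (u : R -> H) := forall t : R, 0 <= t <= T ->
  forall e : R, 0 < e -> exists2 d : R, 0 < d &
    forall r : R, 0 <= r <= T -> `|r - t| < d -> rnorm (u r - u t) < e.

Lemma rnorm_cauchy_cvg (w : nat -> H) :
  (forall e : R, 0 < e -> exists N, forall n, (N <= n)%N -> rnorm (w N - w n) < e) ->
  exists l, forall e : R, 0 < e -> \forall n \near \oo, rnorm (l - w n) < e.
Proof.
move=> cw; have cv : cvgn w.
  apply: cauchy_cvg; apply: cauchy_exP => e; rewrite ltcE/= => /andP[/eqP Ie Re0].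
  have [N HN] := cw _ Re0; exists (w N); exists N => // n Nn.
  by rewrite /= -ball_normE /ball_/= rnormE ltcE/= Ie eqxx HN.
by exists (lim (w @ \oo)); move/rnorm_cvgP : cv.
Qed.

(** The value at [t] is the limit of [g] along points of [P], a set of full
    measure, that tend to [t]. It exists because [g] is Cauchy near [t]. *)
Lemma extend_by_continuity (T : R) (P : R -> Prop) (g : R -> H) : 0 < T ->
  {ae leb R, forall t : R, 0 <= t <= T -> P t} ->
  (forall t : R, 0 <= t <= T -> forall e : R, 0 < e -> exists2 d : R, 0 < d &
    forall r r' : R, P r -> P r' -> 0 <= r <= T -> 0 <= r' <= T ->
      `|r - t| < d -> `|r' - t| < d -> rnorm (g r - g r') < e) ->
  exists2 u : R -> H, forall t : R, 0 <= t <= T -> P t -> u t = g t &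
    eps_continuous_vec T u.
Proof.
move=> T0 aeP cg.
have lim_ex t : exists l : H, 0 <= t <= T -> forall e : R, 0 < e -> exists2 d, 0 < d &
    forall r, P r -> 0 <= r <= T -> `|r - t| < d -> rnorm (g r - l) < e.
  have [tT|] := boolP (0 <= t <= T); last by exists 0.
  have tn n : {r | [/\ 0 <= r <= T, `|r - t| < n.+1%:R^-1 & P r]}.
    by apply: cid; apply: ae_leb_near => //; rewrite invr_gt0.
  pose w n := sval (tn n).
  have wP n : [/\ 0 <= w n <= T, `|w n - t| < n.+1%:R^-1 & P (w n)] := svalP (tn n).
  have wd d : 0 < d -> \forall n \near \oo, `|w n - t| < d.
    move=> d0; have := near_infty_natSinv_lt (PosNum d0).
    by apply: filterS => n; apply: lt_trans; have [] := wP n.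
  have [e e0|l Hl] := @rnorm_cauchy_cvg (g \o w).
    have [d d0 Hd] := cg t tT e e0; have [N _ HN] := wd d d0.
    exists N => n Nn; have [? _ ?] := wP N; have [? _ ?] := wP n.
    by apply: Hd => //; [exact: (HN N (leqnn N))|exact: HN].
  exists l => _ e e0; have e20 : 0 < e / 2 by rewrite divr_gt0.
  have [d d0 Hd] := cg t tT _ e20; exists d => // r Pr rT rd.
  have [n [h1 h2]] : exists n, `|w n - t| < d /\ rnorm (l - g (w n)) < e / 2.
    have [N _ HN] := filterI (wd d d0) (Hl _ e20).
    by exists N; exact: (HN N (leqnn N)).
  have [wT _ Pw] := wP n; have h3 := Hd _ _ Pr Pw rT wT rd h1.
  have := ler_rnormD (g r - g (w n)) (g (w n) - l).
  by rewrite addrA subrK [rnorm (g (w n) - l)]rnormBC; lra.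
have [u Hu] := choice lim_ex; exists u => [t tT Pt|t tT e e0].
  apply/eqP; rewrite eq_sym -subr_eq0 -normr_eq0 rnormE; apply/eqP; congr (real_complex _ _).
  apply: (@eq0_le_eps _ _ 1) => e e0; rewrite mul1r ger0_norm ?rnorm_ge0//.
  have [d d0 Hd] := Hu t tT e e0; apply/ltW/Hd => //.
  by rewrite subrr normr0.
have e20 : 0 < e / 2 by rewrite divr_gt0.
have [d d0 Hd] := Hu t tT _ e20; exists d => // r rT rd.
have [d' d'0 Hd'] := Hu r rT _ e20.
have m0 : 0 < Num.min d' (d - `|r - t|) by rewrite lt_min d'0 subr_gt0.
have [q [qT qd Pq]] := ae_leb_near T0 rT m0 aeP.
move: qd; rewrite lt_min => /andP[qd1 qd2].
have h1 := Hd' q Pq qT qd1.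
have h2 : rnorm (g q - u t) < e / 2.
  by apply: Hd => //; have := ler_normD (q - r) (r - t); rewrite addrA subrK; lra.
have := ler_rnormD (u r - g q) (g q - u t); rewrite addrA subrK rnormBC.
rewrite [rnorm (u r - g q)]rnormBC rnormBC; lra.
Qed.

End Extension.

(** * Strong measurability and Young's inequality *)

Section StrongMeasurability.
Context {R : realType}.
Notation L := (lebesgueType R).

(** On each level set of the simple function [s n] the integrand is one of the
    measurable functions [F ^~ x], and there are finitely many such sets. An
    almost everywhere limit of measurable functions is measurable because the
    measure is complete. *)
Lemma measurable_strong_limit (V : Type) (T : R) (F : R -> V -> R)
    (s : nat -> R -> V) (v : R -> V) :
  (forall n, finite_set (range (s n))) ->
  (forall n x, measurable (s n @^-1` [set x] : set L)) ->
  (forall x, measurable_fun (`[0, T] : set L) (F ^~ x : L -> R)) ->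
  {ae leb R, forall t : R, 0 <= t <= T -> F t (s n t) @[n --> \oo] --> F t (v t)} ->
  measurable_fun (`[0, T] : set L) ((fun t => F t (v t)) : L -> R).
Proof.
move=> sfin ms mF cF.
have m0T := measurable_leb_itv (0 : R) T.
have mFs n : measurable_fun (`[0, T] : set L) ((fun t => F t (s n t)) : L -> R).
  move=> _ Y mY.
  have -> : `[0, T] `&` (fun t => F t (s n t)) @^-1` Y =
      \bigcup_(x in range (s n)) (s n @^-1` [set x] `&` (`[0, T] `&` (F ^~ x) @^-1` Y)).
    apply/seteqP; split => [t [tT Yt]|t [x _ [/= <- [tT Yt]]]]; last by split.
    by exists (s n t); [exists t|split].
  apply: fin_bigcup_measurable => // x _; apply: measurableI; first exact: ms.
  exact: mF.
have mS : measurable_fun (`[0, T] : set L)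
    (fun t : L => limn_esup (fun n => (F t (s n t))%:E)).
  apply: measurable_fun_limn_esup => n; exact/measurable_EFinP.
apply/measurable_EFinP.
apply: (ae_measurable_fun (@completed_lebesgue_measure_is_complete R) _ mS).
apply: ae_lebS cF => t ct; rewrite /= in_itv/= => tT.
apply: (cvg_limn_einf_sup _).2.
by apply: cvg_EFin; [exact: nearW|exact: ct].
Qed.

Lemma young_le (p a b : R) : 1 < p -> 0 <= a -> 0 <= b ->
  b * a <= a `^ p + b `^ (p / (p - 1)).
Proof.
move=> p1 a0 b0; have p0 : 0 < p by exact: lt_trans p1.
have p10 : 0 < p - 1 by rewrite subr_gt0.
have q0 : 0 < p / (p - 1) by rewrite divr_gt0.
rewrite mulrC; apply: le_trans (@conjugate_powR R a b p (p / (p - 1)) a0 b0 p0 q0 _) _.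
  by rewrite invf_div; field; rewrite !gt_eqF.
apply: lerD; rewrite ler_pdivrMr// ler_peMr ?powR_ge0// ?ltW//.
by rewrite ltr_pdivlMr// mul1r gtrBl.
Qed.

Lemma le_1_powR (a p : R) : 1 <= p -> 0 <= a -> a <= 1 + a `^ p.
Proof.
move=> p1 a0; have [a1|/ltW a1] := leP a 1.
  by rewrite (le_trans a1)// lerDl powR_ge0.
by rewrite (le_trans (le1r_powR a1 p1))// lerDr.
Qed.

End StrongMeasurability.

(** * The energy equality for a real pairing *)

(** The scalar setting: [rho t x] is the real part of [<v*_t, x>], and the
    functions [alpha] and [beta] come from Young's inequality. *)
Section Core.
Context {R : realType} {V : normedModType R[i]} {H : completeNormedModType R[i]}.
Notation L := (lebesgueType R).
Context (ip : {dot H for @Num.conj R[i]}) (ipH : inner_product_norm ip).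
Context (inc : {linear V -> H}).
Context (inc_norm : forall x : V, rnorm (inc x) <= rnorm x).
Context (T : R) (T0 : 0 < T).
Context (v : R -> V) (s : nat -> R -> V).
Context (s_fin : forall n, finite_set (range (s n))).
Context (s_meas : forall n x, measurable (s n @^-1` [set x] : set L)).
Context (s_cvg : {ae leb R, forall t : R, 0 <= t <= T -> s n t @[n --> \oo] --> v t}).
Context (rho : R -> V -> R) (f alpha beta : R -> R).
Context (rhoB : forall t x y, rho t (x - y) = rho t x - rho t y).
Context (rho_le : forall (t : R) x, 0 <= t <= T -> `|rho t x| <= f t * rnorm x).
Context (rho_meas : forall x, measurable_fun (`[0, T] : set L) (rho ^~ x : L -> R)).
Context (f_ge0 : forall t : R, 0 <= t <= T -> 0 <= f t) (f_int : lebint T f).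
Context (alpha_ge0 : forall t : R, 0 <= t <= T -> 0 <= alpha t) (alpha_int : lebint T alpha).
Context (beta_ge0 : forall t : R, 0 <= t <= T -> 0 <= beta t) (beta_int : lebint T beta).
Context (S0 : set R) (aeS0 : {ae leb R, forall t : R, 0 <= t <= T -> S0 t}).
Context (young : forall q r, S0 q -> S0 r -> 0 <= q <= T -> 0 <= r <= T ->
  f q * rnorm (v r) <= alpha r + beta q).
Context (weak : forall x : V, exists c : R, {ae leb R, forall t : R, 0 <= t <= T ->
  rip ip (inc (v t)) (inc x) = c + primitive (rho ^~ x) t}).

Let g t := inc (v t).
Let rip' := rip ip.
Let prim x := primitive (rho ^~ x).
Let D : set V := \bigcup_n range (s n).

Lemma rho_int x : lebint T (rho ^~ x).
Proof.
apply: (@lebint_le _ _ _ (fun t => rnorm x * f t)); first exact: rho_meas.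
  exact: lebintZ.
by move=> t tT; rewrite mulrC; exact: rho_le.
Qed.

(** Lipschitz dependence on [x], with a constant that involves only [f]: this is
    what allows replacing [v r] by a nearby value of a simple function. *)
Lemma prim_rhoB x y t r : 0 <= t <= T -> 0 <= r <= T ->
  `|(prim x t - prim x r) - (prim y t - prim y r)| <=
  rnorm (x - y) * `|primitive f t - primitive f r|.
Proof.
move=> /[dup] tT /andP[_ tT'] /[dup] rT /andP[_ rT'].
have -> : prim x t - prim x r - (prim y t - prim y r) =
    prim (x - y) t - prim (x - y) r.
  have E z : z <= T -> prim (x - y) z = prim x z - prim y z.
    move=> zT; rewrite /prim -(primitiveB (rho_int x) (rho_int y) zT).
    by congr primitive; apply/funext => q; exact: rhoB.
  rewrite !E//; ring.
have := @norm_primitive_le R T _ _ r t (rho_int (x - y)) (lebintZ (rnorm (x - y)) f_int) rT tT.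
rewrite !(primitiveZ _ f_int)// -mulrBr normrM (ger0_norm (rnorm_ge0 _)); apply.
  by move=> q qT; rewrite mulr_ge0 ?rnorm_ge0// f_ge0.
by apply: (@filterE _ _ ae_leb_filter) => q qT; rewrite mulrC; exact: rho_le.
Qed.

Lemma countable_values : countable D.
Proof.
apply: bigcup_countable => // n _; exact: finite_set_countable.
Qed.

Lemma values_dense r e : s n r @[n --> \oo] --> v r -> 0 < e ->
  exists2 x, D x & rnorm (v r - x) < e.
Proof.
move=> /rnorm_cvgP cs e0; have [N _ HN] := cs e e0.
exists (s N r); first by exists N => //; exists r.
by apply: HN => /=.
Qed.

Lemma weak_const : exists c : V -> R, forall x, {ae leb R, forall t : R, 0 <= t <= T ->
  rip' (g t) (inc x) = c x + prim x t}.
Proof. by have [c Hc] := choice weak; exists c. Qed.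

(** The properties required of a point [t], each of which holds almost
    everywhere. Those that depend on a vector [x] are required only for [x] in the
    countable set [D], whose closure contains [v t]. *)
Record regular (c : V -> R) (t : R) : Prop := Regular {
  regular_cvg : s n t @[n --> \oo] --> v t;
  regular_weak : forall x, D x -> rip' (g t) (inc x) = c x + prim x t;
  regular_deriv : 0 < t < T -> forall x, D x -> eps_derivable T (prim x) t (rho t x);
  regular_deriv_majorant : 0 < t < T -> eps_derivable T (primitive f) t (f t);
  regular_young : S0 t }.

Lemma ae_regular c : (forall x, {ae leb R, forall t : R, 0 <= t <= T ->
  rip' (g t) (inc x) = c x + prim x t}) ->
  {ae leb R, forall t : R, 0 <= t <= T -> regular c t}.
Proof.
move=> Hc.
have h1 := ae_leb_countable countable_values (fun x (_ : D x) => Hc x).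
have h2 := ae_leb_countable countable_values (fun x (_ : D x) => primitive_derivable (rho_int x)).
have h3 := primitive_derivable f_int.
have := ae_lebI (ae_lebI h1 h2) (ae_lebI h3 (ae_lebI s_cvg aeS0)).
apply: ae_lebS => t [[w d] [df [sc S0t]]] tT; split.
- exact: sc.
- by move=> x Dx; exact: w.
- by move=> t0T x Dx; exact: d.
- exact: df.
- exact: S0t.
Qed.

Section Regular.
Context (c : V -> R).
Notation S := (regular c).

(** For [x] in [D] close to [v r], the weak equation at [r] and [t] gives the
    equality with [x] instead of [v r]; both sides are Lipschitz in [x]. *)
Lemma weak_increment r t : S r -> S t -> 0 <= r <= T -> 0 <= t <= T ->
  rip' (g t - g r) (g r) = prim (v r) t - prim (v r) r.
Proof.
move=> Sr St rT tT; apply/eqP; rewrite -subr_eq0; apply/eqP.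
apply: (@eq0_le_eps _ _ (rnorm (g t - g r) + `|primitive f t - primitive f r|)) => e e0.
have [x Dx xe] := values_dense (regular_cvg Sr) e0.
have -> : rip' (g t - g r) (g r) - (prim (v r) t - prim (v r) r) =
  rip' (g t - g r) (inc (v r - x)) -
  ((prim (v r) t - prim (v r) r) - (prim x t - prim x r)).
  have -> : inc (v r - x) = inc (v r) - inc x by exact: linearB.
  rewrite /rip' ripBr !ripBl.
  have := regular_weak St Dx; have := regular_weak Sr Dx.
  by rewrite /rip' => -> ->; ring.
apply: le_trans (ler_normB _ _) _; rewrite mulrDl; apply: lerD.
  apply: le_trans (ler_rip ipH _ _) _; apply: ler_wpM2l; first exact: rnorm_ge0.
  exact: le_trans (inc_norm _) (ltW xe).
apply: le_trans (prim_rhoB _ _ tT rT) _.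
by rewrite mulrC ler_wpM2l// ltW.
Qed.

(** The same approximation: at [r] the primitive of [rho ^~ x] is differentiable
    for [x] in [D], and the error made by replacing [v r] by [x] is controlled by
    the difference quotients of the primitive of [f], which are bounded since
    they converge to [f r]. *)
Lemma prim_derivable r : S r -> 0 < r < T ->
  eps_derivable T (prim (v r)) r (rho r (v r)).
Proof.
move=> Sr /[dup] rT /andP[r0 rT'] e e0.
have rTc : 0 <= r <= T by rewrite !ltW.
have fr0 := f_ge0 rTc.
have c0 : 0 < 2 * f r + 1 by lra.
have e1 : 0 < e / 2 / (2 * f r + 1) by rewrite !divr_gt0.
have [x Dx] := values_dense (regular_cvg Sr) e1; rewrite ltr_pdivlMr// => xe.
have e2 : 0 < e / 2 by rewrite divr_gt0.
have [d1 d10 H1] := regular_deriv Sr rT Dx e2.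
have [d2 d20 H2] := regular_deriv_majorant Sr rT ltr01.
exists (Num.min d1 d2); first by rewrite lt_min d10.
move=> h hn0; rewrite lt_min => /andP[hd1 hd2] rh.
have := H1 h hn0 hd1 rh; have := H2 h hn0 hd2 rh => h2 h1.
have b1 := prim_rhoB (v r) x rh rTc.
have b2 : `|rho r (v r) - rho r x| <= f r * rnorm (v r - x).
  by rewrite -rhoB; exact: rho_le.
set P := prim (v r) (r + h) - prim (v r) r in b1 *.
set Q := prim x (r + h) - prim x r in b1 h1.
set F := primitive f (r + h) - primitive f r in b1 h2.
have b3 : `|h^-1 * P - h^-1 * Q| <= rnorm (v r - x) * (f r + 1).
  rewrite -mulrBr normrM; apply: le_trans (ler_wpM2l (normr_ge0 _) b1) _.
  rewrite mulrCA ler_wpM2l ?rnorm_ge0// -normrM.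
  by have := ler_normD (h^-1 * F - f r) (f r); rewrite subrK (ger0_norm fr0); lra.
have -> : h^-1 * P - rho r (v r) = (h^-1 * P - h^-1 * Q) + (h^-1 * Q - rho r x)
   + (rho r x - rho r (v r)) by ring.
have n1 := ler_normD (h^-1 * P - h^-1 * Q + (h^-1 * Q - rho r x)) (rho r x - rho r (v r)).
have n2 := ler_normD (h^-1 * P - h^-1 * Q) (h^-1 * Q - rho r x).
rewrite distrC in b2; rewrite mulrC in b2.
apply: le_lt_trans n1 _.
have -> : e = e / 2 + e / 2 by field.
have : rnorm (v r - x) * (2 * f r + 1) = rnorm (v r - x) * (f r + 1) + rnorm (v r - x) * f r.
  by ring.
lra.
Qed.

Lemma prim_bound r t : S r -> 0 <= r <= T -> 0 <= t <= T ->
  `|prim (v r) t - prim (v r) r| <=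
  alpha r * `|t - r| + `|primitive beta t - primitive beta r|.
Proof.
move=> Sr rT tT.
have ib : lebint T (fun q => alpha r + beta q).
  by apply: lebintD => //; exact: lebint_cst.
have := @norm_primitive_le R T _ _ r t (rho_int (v r)) ib rT tT.
have Eb q : 0 <= q <= T -> primitive (fun q => alpha r + beta q) q =
    alpha r * q + primitive beta q.
  move=> /andP[q0 qT]; rewrite (primitiveD (lebint_cst _ _) beta_int qT).
  by rewrite primitive_cst.
rewrite !Eb// => h; apply: le_trans (h _ _) _.
- by move=> q qT; rewrite addr_ge0 ?beta_ge0 ?alpha_ge0.
- apply: ae_lebS aeS0 => q S0q qT; apply: le_trans (rho_le _ qT) _.
  by apply: young => //; [exact: S0q|exact: regular_young Sr].
- have -> : alpha r * t + primitive beta t - (alpha r * r + primitive beta r) =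
    alpha r * (t - r) + (primitive beta t - primitive beta r) by ring.
  apply: le_trans (ler_normD _ _) _.
  by rewrite normrM (ger0_norm (alpha_ge0 rT)).
Qed.

Lemma norm_increment r t : S r -> S t -> 0 <= r <= T -> 0 <= t <= T ->
  rnorm (g t) ^+ 2 - rnorm (g r) ^+ 2 =
  2 * (prim (v r) t - prim (v r) r) + rnorm (g t - g r) ^+ 2.
Proof.
by move=> Sr St rT tT; rewrite -(weak_increment Sr St rT tT); exact: rip_increment.
Qed.

Context (aeS : {ae leb R, forall t : R, 0 <= t <= T -> S t}).

(** The square of the norm of [g] is integrable even when the norm of [v] is
    merely integrable: comparing with one fixed point [r] of [S] bounds it by a
    constant plus a multiple of [alpha]. *)
Lemma norm_int : lebint T (fun t => rnorm (g t) ^+ 2).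
Proof.
have T00 : 0 <= (0 : R) <= T by apply/andP; split => //; exact: ltW.
have [r [rT _ Sr]] := ae_leb_near T0 T00 ltr01 aeS.
pose b t := (rnorm (g r) ^+ 2 + 2 * primitive beta T) + 2 * T * alpha t.
apply: (@lebint_ae_le _ _ _ b).
- apply: (@measurable_strong_limit _ _ _ (fun _ x => rnorm (inc x) ^+ 2) s) => //.
  apply: ae_lebS s_cvg => t ct tT.
  rewrite expr2; under eq_fun do rewrite expr2.
  have ci : rnorm (inc (s n t)) @[n --> \oo] --> rnorm (inc (v t)).
    apply/cvgrPdist_lt => e e0.
    have : \forall n \near \oo, rnorm (v t - s n t) < e.
      by move/rnorm_cvgP : (ct tT) => /(_ e e0).
    apply: filterS => n h; apply: le_lt_trans h; apply: (le_trans (ler_rnormB _ _)).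
    have <- : inc (v t - s n t) = inc (v t) - inc (s n t) by exact: linearB.
    exact: inc_norm.
  exact: cvgM.
- by apply: lebintD; [exact: lebint_cst|exact: lebintZ].
- apply: ae_lebS aeS => t St tT; have {}St := St tT.
  rewrite ger0_norm ?sqr_ge0//.
  have := norm_increment St Sr tT rT.
  have := prim_bound St tT rT.
  have := sqr_ge0 (rnorm (g r - g t)).
  have Ble q : 0 <= q <= T -> 0 <= primitive beta q <= primitive beta T.
    move=> /[dup] qT /andP[q0 qT']; rewrite (primitive_ge0 qT)//=.
    exact: (primitive_nondecreasing beta_int).
  have hB : `|primitive beta r - primitive beta t| <= primitive beta T.
    have /andP[? ?] := Ble r rT; have /andP[? ?] := Ble t tT.
    by rewrite ler_norml; apply/andP; split; lra.
  have hr : `|r - t| <= T.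
    by move: rT tT => /andP[? ?] /andP[? ?]; rewrite ler_norml; apply/andP; split; lra.
  have ha := ler_wpM2l (alpha_ge0 tT) hr.
  rewrite ler_norml /b => h1 /andP[h2 _] h3.
  have -> : 2 * T * alpha t = 2 * (alpha t * T) by ring.
  lra.
Qed.

Lemma pairing_int : lebint T (fun t => rho t (v t)).
Proof.
apply: (@lebint_ae_le _ _ _ (fun t => alpha t + beta t)).
- apply: (@measurable_strong_limit _ _ _ rho s) => //.
  apply: ae_lebS s_cvg => t ct tT; apply/cvgrPdist_lt => e e0.
  have f1 : 0 < f t + 1 by rewrite ltr_wpDl// f_ge0.
  have : \forall n \near \oo, rnorm (v t - s n t) < e / (f t + 1).
    by move/rnorm_cvgP : (ct tT) => /(_ _ (divr_gt0 e0 f1)).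
  apply: filterS => n; rewrite ltr_pdivlMr// -rhoB => h.
  apply: le_lt_trans (rho_le _ tT) _.
  by have := rnorm_ge0 (v t - s n t); nra.
- exact: lebintD.
- apply: ae_lebS aeS0 => t S0t tT; apply: le_trans (rho_le _ tT) _.
  by apply: young => //; exact: S0t.
Qed.

Lemma energy : exists2 G : set R,
  {ae leb R, forall t : R, 0 <= t <= T -> G t} &
  forall a b, G a -> G b -> rnorm (g b) ^+ 2 - rnorm (g a) ^+ 2 =
    2 * (primitive (fun t => rho t (v t)) b - primitive (fun t => rho t (v t)) a).
Proof.
apply: (@energy_identity R T (fun t => rnorm (g t) ^+ 2) (fun t => rho t (v t))
  alpha beta (fun r => prim (v r)) S T0 norm_int pairing_int) => //.
- move=> r t Sr St rT tT; rewrite (norm_increment Sr St)//.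
  by rewrite lerDl sqr_ge0.
- exact: prim_bound.
- exact: prim_derivable.
Qed.

End Regular.

(** The estimate called [dist] in the proof is not symmetric in its two points:
    [alpha r] may be large. Near a given [t], all the points are therefore
    compared with one well chosen [r]. *)
Lemma continuous_version : exists2 u : R -> H,
  {ae leb R, forall t : R, 0 <= t <= T -> u t = g t} &
  eps_continuous_vec T u /\
  exists a, {ae leb R, forall t : R, 0 <= t <= T ->
     rnorm (g t) ^+ 2 = a + 2 * primitive (fun t => rho t (v t)) t}.
Proof.
have [c Hc] := weak_const.
have aeS := ae_regular Hc.
have [G aeG EG] := energy aeS.
pose K := primitive (fun t => rho t (v t)).
pose Bt := primitive beta.
pose A := primitive alpha.
pose P t := regular c t /\ G t.
have aeP : {ae leb R, forall t : R, 0 <= t <= T -> P t}.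
  by apply: ae_lebS (ae_lebI aeS aeG) => t [h1 h2] tT; split; [exact: h1|exact: h2].
have dist r t : P r -> P t -> 0 <= r <= T -> 0 <= t <= T ->
    rnorm (g t - g r) ^+ 2 <= 2 * `|K t - K r| +
      2 * (alpha r * `|t - r| + `|Bt t - Bt r|).
  move=> [Sr Gr] [St Gt] rT tT.
  have := norm_increment Sr St rT tT; rewrite (EG _ _ Gr Gt) -/K.
  have := prim_bound Sr rT tT; rewrite ler_norml => /andP[h1 _] h2.
  have := ler_norm (K t - K r); rewrite -/Bt in h1; lra.
have cK := primitive_continuous (pairing_int).
have cB := primitive_continuous beta_int.
have cA := primitive_continuous alpha_int.
have cauchy (t : R) : 0 <= t <= T -> forall e : R, 0 < e -> exists2 d : R, 0 < d &
    forall r r' : R, P r -> P r' -> 0 <= r <= T -> 0 <= r' <= T ->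
      `|r - t| < d -> `|r' - t| < d -> rnorm (g r - g r') < e.
  move=> tT e e0; pose e1 := e ^+ 2 / 64.
  have e10 : 0 < e1 by rewrite divr_gt0// exprn_gt0.
  have [dK dK0 HK] := cK t tT _ e10.
  have [dB dB0 HB] := cB t tT _ e10.
  have [dA dA0 HA] := cA t tT _ e10.
  have [d d0 dd] : exists2 d : R, 0 < d & forall r : R,
      `|r - t| < d -> [/\ `|r - t| < dK, `|r - t| < dB & `|r - t| < dA].
    exists (Num.min dK (Num.min dB dA)) => [|r]; first by rewrite !lt_min dK0 dB0.
    by rewrite !lt_min => /and3P[].
  pose lo := Num.max 0 (t - d / 2); pose hi := Num.min T (t + d / 2).
  have [t0 tT'] := andP tT.
  have lohi : lo < hi.
    rewrite /lo /hi lt_min !gt_max; apply/andP.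
    by split; apply/andP; split; [exact: T0|lra|lra|lra].
  have lo0 : 0 <= lo by rewrite le_max lexx.
  have hiT : hi <= T by rewrite ge_min lexx.
  have inI (r : R) : 0 <= r <= T -> `|r - t| < d / 2 -> lo <= r <= hi.
    move=> /andP[r0 rT]; rewrite ltr_norml => /andP[h1 h2].
    rewrite /lo /hi ge_max le_min r0 rT /=; apply/andP; split; lra.
  have Iin (r : R) : lo <= r <= hi -> 0 <= r <= T /\ `|r - t| < d.
    rewrite /lo /hi ge_max le_min => /andP[/andP[r0 h1] /andP[rT h2]].
    by rewrite r0 rT; split => //; rewrite ltr_norml; apply/andP; split; lra.
  have [r [rI Pr ar]] := exists_le_mean alpha_int alpha_ge0 aeP lo0 lohi hiT e10.
  have osc (F : R -> R) (q : R) :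
      (forall s : R, 0 <= s <= T -> `|s - t| < d -> `|F s - F t| < e1) ->
      0 <= q <= T -> `|q - t| < d -> forall q' : R, 0 <= q' <= T -> `|q' - t| < d ->
      `|F q - F q'| < 2 * e1.
    move=> HF qT qd q' q'T q'd.
    have := ler_normD (F q - F t) (F t - F q'); rewrite addrA subrK.
    have := HF q qT qd; have := HF q' q'T q'd; rewrite distrC; lra.
  have {}HK q : 0 <= q <= T -> `|q - t| < d -> `|K q - K t| < e1.
    by move=> qT /dd[h _ _]; exact: HK.
  have {}HB q : 0 <= q <= T -> `|q - t| < d -> `|Bt q - Bt t| < e1.
    by move=> qT /dd[_ h _]; exact: HB.
  have {}HA q : 0 <= q <= T -> `|q - t| < d -> `|A q - A t| < e1.
    by move=> qT /dd[_ _ h]; exact: HA.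
  have [rT rd] := Iin r rI.
  have lohiA : primitive alpha hi - primitive alpha lo < 2 * e1.
    have [loT lod] : 0 <= lo <= T /\ `|lo - t| < d.
      by apply: Iin; rewrite lexx ltW.
    have [hiT2 hid] : 0 <= hi <= T /\ `|hi - t| < d.
      by apply: Iin; rewrite lexx ltW.
    exact: le_lt_trans (ler_norm _) (osc A hi HA hiT2 hid lo loT lod).
  (* r is the point of the interval where alpha is at most about its mean *)
  have main q : P q -> 0 <= q <= T -> `|q - t| < d / 2 -> rnorm (g q - g r) < e / 2.
    move=> Pq qT qd2; have qd : `|q - t| < d by lra.
    have qr : `|q - r| <= hi - lo.
      have /andP[? ?] := inI q qT qd2; have /andP[? ?] := rI.
      by rewrite ler_norml; apply/andP; split; lra.
    have := dist r q Pr Pq rT qT.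
    have := osc K q HK qT qd r rT rd; have := osc Bt q HB qT qd r rT rd => h1 h2 h3.
    have h4 := ler_wpM2l (alpha_ge0 rT) qr.
    have h5 : rnorm (g q - g r) ^+ 2 < (e / 2) ^+ 2.
      have -> : (e / 2) ^+ 2 = 16 * e1 by rewrite /e1; field.
      lra.
    by move: h5; rewrite ltr_pXn2r// nnegrE ?rnorm_ge0// divr_ge0// ltW.
  exists (d / 2); first by rewrite divr_gt0.
  move=> q q' Pq Pq' qT q'T qd q'd.
  have := ler_rnormD (g q - g r) (g r - g q'); rewrite addrA subrK.
  have := main q Pq qT qd; have := main q' Pq' q'T q'd.
  rewrite [rnorm (g q' - g r)]rnormBC; lra.
have [u uP cu] := extend_by_continuity T0 aeP cauchy.
exists u; first by apply: ae_lebS aeP => t Pt tT; exact: uP (Pt tT).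
split => //.
have T00 : 0 <= (0 : R) <= T by apply/andP; split => //; exact: ltW.
have [r [rT _ [_ Gr]]] := ae_leb_near T0 T00 ltr01 aeP.
exists (rnorm (g r) ^+ 2 - 2 * K r).
apply: ae_lebS aeG => t Gt tT.
by have := EG _ _ Gr (Gt tT); rewrite -/K; lra.
Qed.

Theorem energy_equality : exists u : R -> H,
  [/\ eps_continuous_vec T u,
      {ae leb R, forall t : R, 0 <= t <= T -> u t = inc (v t)},
      forall (t : R) x, 0 <= t <= T -> rip ip (u t) (inc x) =
        rip ip (u 0) (inc x) + primitive (rho ^~ x) t &
      forall t : R, 0 <= t <= T -> rnorm (u t) ^+ 2 =
        rnorm (u 0) ^+ 2 + 2 * primitive (fun t => rho t (v t)) t].
Proof.
have [u ug [cu [a Ha]]] := continuous_version.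
have T00 : 0 <= (0 : R) <= T by apply/andP; split => //; exact: ltW.
exists u; split => // [t x tT|t tT].
  have [b Hb] := weak x.
  have cl : eps_continuous T (fun q => rip ip (u q) (inc x)).
    move=> r rT e e0.
    have n0 : 0 < rnorm (inc x) + 1 by rewrite ltr_wpDl// rnorm_ge0.
    have [d d0 Hd] := cu r rT _ (divr_gt0 e0 n0); exists d => // y yT yr.
    rewrite -ripBl; apply: le_lt_trans (ler_rip ipH _ _) _.
    have := Hd y yT yr; rewrite ltr_pdivlMr//.
    by have := rnorm_ge0 (u y - u r); nra.
  have cr := eps_continuousZD b 1 (primitive_continuous (rho_int x)).
  have ae : {ae leb R, forall q : R, 0 <= q <= T ->
      rip ip (u q) (inc x) = b + 1 * primitive (rho ^~ x) q}.
    apply: ae_lebS (ae_lebI ug Hb) => q [h1 h2] qT.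
    by rewrite h1// mul1r; exact: h2.
  rewrite !(eps_continuous_eq T0 cl cr ae)//.
  by rewrite (primitive0 (ltW T0) (rho_int x)); ring.
have cn : eps_continuous T (fun q => rnorm (u q)).
  move=> r rT e e0; have [d d0 Hd] := cu r rT e e0.
  by exists d => // y yT yr; apply: le_lt_trans (ler_rnormB _ _) _; exact: Hd.
have ae : {ae leb R, forall q : R, 0 <= q <= T ->
    rnorm (u q) ^+ 2 = a + 2 * primitive (fun t => rho t (v t)) q}.
  by apply: ae_lebS (ae_lebI ug Ha) => y [h1 h2] yT; rewrite h1//; exact: h2.
have E := eps_continuous_eq T0 (eps_continuous_sqr cn)
  (eps_continuousZD a 2 (primitive_continuous pairing_int)) ae.
rewrite !E// (primitive0 (ltW T0) pairing_int); ring.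
Qed.

End Core.

(** * Antiduals, complex integrals and the integrability hypotheses *)

Section Dual.
Context {R : realType} {V : normedModType R[i]}.
Implicit Types (phi : antidual V) (x y : V).

Lemma dual_norm_ubound phi :
  has_ubound [set rnorm (phi x) | x in [set x : V | rnorm x <= 1]].
Proof.
have [M HM] := antidual_bounded phi.
exists `|M| => _ [x /= x1 <-]; apply: le_trans (HM x) _.
by have := ler_norm M; have := rnorm_ge0 x; have := normr_ge0 M; nra.
Qed.

Lemma dual_norm_ge0 phi : 0 <= dual_norm phi.
Proof.
have -> : 0 = rnorm (phi 0) by rewrite linear0 /rnorm normr0.
apply: ub_le_sup; first exact: dual_norm_ubound.
by exists 0 => //=; rewrite rnorm0.
Qed.

(** Homogeneity: apply the definition of the supremum to [x / |x|]. *)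
Lemma rnorm_antidual_le phi x : rnorm (phi x) <= dual_norm phi * rnorm x.
Proof.
have [x0|xn0] := eqVneq (rnorm x) 0.
  have -> : x = 0 by apply/eqP; rewrite -normr_eq0 rnormE x0.
  by rewrite linear0 rnorm0 mulr0 /rnorm normr0.
have xp : 0 < rnorm x by rewrite lt_def xn0 rnorm_ge0.
rewrite -ler_pdivrMr//; apply: ub_le_sup; first exact: dual_norm_ubound.
exists ((rnorm x)^-1%:C *: x) => /=.
  by rewrite rnormZ ger0_norm ?invr_ge0 ?rnorm_ge0// mulVf.
rewrite linearZ_LR/=.
have -> : Num.conj ((rnorm x)^-1%:C) = (rnorm x)^-1%:C :> R[i] by exact: conjc_real.
have Rn (a : R) (z : R[i]) : 0 <= a -> rnorm (a%:C * z) = a * rnorm z.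
  move=> a0; rewrite /rnorm normrM.
  have -> : `|a%:C| = a%:C :> R[i] by rewrite ger0_norm// ler0c.
  exact: Re_realM.
by rewrite Rn ?invr_ge0 ?ltW// mulrC.
Qed.

Lemma antidual_ReB phi x y :
  complex.Re (phi (x - y)) = complex.Re (phi x) - complex.Re (phi y).
Proof. by rewrite linearB/= ReD ReN. Qed.

(** [phi] is conjugate-linear, so that [phi (i x) = - i phi x]. *)
Lemma antidual_Im phi x : complex.Im (phi x) = complex.Re (phi ('i%C *: x)).
Proof. by rewrite linearZ_LR/=; case: (phi x) => a b /=; ring. Qed.

End Dual.

Section Assemble.
Context {R : realType}.
Notation L := (lebesgueType R).

Lemma ip_Im (H : normedModType R[i]) (ip : {dot H for @Num.conj R[i]}) x y :
  complex.Im (ip x y) = rip ip x ('i%C *: y).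
Proof.
rewrite /rip linearZr_LR/=.
have E (z : R[i]) : complex.Im z = complex.Re (Num.conj 'i%C * z).
  by case: z => a b /=; ring.
exact: E.
Qed.

Lemma Re_oriented_integral (T s t : R) (F : R -> R[i]) :
  lebint T (fun r => complex.Re (F r)) -> 0 <= s <= T -> 0 <= t <= T ->
  complex.Re (oriented_integral s t F) =
  primitive (fun r => complex.Re (F r)) t - primitive (fun r => complex.Re (F r)) s.
Proof.
move=> iF /andP[s0 sT] /andP[t0 tT]; rewrite /oriented_integral.
case: leP => [st|/ltW ts].
  by rewrite /= (primitive_itv iF).
by rewrite /= (primitive_itv iF)// opprB.
Qed.

Lemma eps_continuous_vec_within (H : completeNormedModType R[i]) (T : R) (u : R -> H) :
  eps_continuous_vec T u -> {within `[0, T], continuous u}.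
Proof.
move=> cu; apply/subspace_continuousP => t; rewrite /= in_itv/= => tT.
apply/rnorm_cvgP => e e0; have [d d0 Hd] := cu t tT e e0.
exists d => //= r rd rT; rewrite rnormBC; apply: Hd; first by move: rT; rewrite in_itv.
by move: rd; rewrite /ball_/= distrC.
Qed.

(** The measurability of [b] is a consequence of the completeness of the
    measure. *)
Lemma ae_eq_primitive (T : R) (a b : R -> R) (t : R) : lebint T a ->
  {ae leb R, forall r : R, 0 <= r <= T -> a r = b r} -> t <= T ->
  \int[leb R]_(r in `[0, t]) b r = primitive a t.
Proof.
move=> ia ab tT; rewrite /primitive /Rintegral; congr fine; apply/esym.
have mt := measurable_leb_itv (0 : R) t.
have ma : measurable_fun (`[0, t]%classic : set L) (fun r : L => (a r)%:E).
  exact: measurable_int (lebintS ia (lexx 0) tT).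
have ae : ae_eq (leb R) (`[0, t]%classic : set L) (fun r : L => (a r)%:E)
    (fun r : L => (b r)%:E).
  apply: ae_lebS ab => r abr; rewrite /= in_itv/= => /andP[r0 rt].
  by rewrite abr// r0 (le_trans rt tT).
apply: (@ae_eq_integral _ L R (leb R) _ _ _ mt ma _ ae).
exact: (ae_measurable_fun (@completed_lebesgue_measure_is_complete R) ae ma).
Qed.

Lemma pairingH_inc (V H : normedModType R[i]) (inc : V -> H) (phi : antidual V) (x : V) :
  injective inc -> pairingH inc phi (inc x) = phi x.
Proof.
move=> inj; rewrite /pairingH asboolT; last by exists x.
by rewrite pinvKV ?inE// => y z _ _; exact: inj.
Qed.

(** In terms of primitives the oriented integral is a difference of the values at
    the two endpoints, so the equation in the pair [(s, t)] separates the
    variables and [ae_constant_prod] applies. *)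
Lemma weak_primitive (V H : normedModType R[i]) (ip : {dot H for @Num.conj R[i]})
    (inc : {linear V -> H}) (T : R) (v : R -> V) (vs : R -> antidual V) (x : V) :
  0 < T -> lebint T (fun r => complex.Re (vs r x)) ->
  {ae (leb R \x leb R)%E, forall st : R * R,
        0 <= st.1 <= T -> 0 <= st.2 <= T ->
        ip (inc (v st.2)) (inc x) - ip (inc (v st.1)) (inc x) =
        oriented_integral st.1 st.2 (fun r => vs r x)} ->
  exists c : R, {ae leb R, forall t : R, 0 <= t <= T ->
    rip ip (inc (v t)) (inc x) = c + primitive (fun r => complex.Re (vs r x)) t}.
Proof.
move=> T0 ix w.
have [c Hc] : exists c : R, {ae leb R, forall t : R, 0 <= t <= T ->
    rip ip (inc (v t)) (inc x) - primitive (fun r => complex.Re (vs r x)) t = c}.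
  apply: ae_constant_prod => //.
  move: w => [N [mN N0 wN]]; exists N; split => // st nP; apply: wN => /= h.
  apply: nP => sT tT; have := h sT tT => /(congr1 (@complex.Re R)).
  rewrite (Re_oriented_integral ix)// ReD ReN /rip; lra.
by exists c; apply: ae_lebS Hc => t Hc tT; rewrite -(Hc tT) subrK.
Qed.

(** Both forms of the integrability hypothesis lead to the same kind of bound.
    For [p > 1] this is Young's inequality, with the exponents [p] and
    [p / (p - 1)]; for [p = 1], [f] is almost everywhere at most [N0], and
    [alpha] is [N0] times the norm while [beta] is zero. *)
Lemma young_majorant (T p N0 : R) (n f : R -> R) : 0 < T -> 1 <= p -> 1 <= N0 ->
  (forall t : R, 0 <= t <= T -> 0 <= n t) -> (forall t : R, 0 <= t <= T -> 0 <= f t) ->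
  measurable_fun (`[0, T]%classic : set L) (n : L -> R) ->
  measurable_fun (`[0, T]%classic : set L) (f : L -> R) ->
  (1 < p -> (\int[leb R]_(t in `[0%R, T]) (n t `^ p + f t `^ (p / (p - 1)))%:E <= N0%:E)%E) ->
  (p = 1 -> {ae leb R, forall t : R, 0 <= t <= T ->
     (\int[leb R]_(r in `[0%R, T]) (n r)%:E + (f t)%:E <= N0%:E)%E}) ->
  exists alpha beta : R -> R, exists S : set R,
    [/\ lebint T f,
       (forall t : R, 0 <= t <= T -> 0 <= alpha t) /\ lebint T alpha,
       (forall t : R, 0 <= t <= T -> 0 <= beta t) /\ lebint T beta,
       {ae leb R, forall t : R, 0 <= t <= T -> S t} &
       forall q r, S q -> S r -> 0 <= q <= T -> 0 <= r <= T ->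
         f q * n r <= alpha r + beta q].
Proof.
move=> T0 p1 N1 n0 f0 mn mf; have mT := measurable_leb_itv (0 : R) T.
have sub (t : R) : `[0, T]%classic t -> 0 <= t <= T by rewrite /= in_itv.
move: p1; rewrite le_eqVlt => /predU1P[<- _ /(_ erefl) Hp|p1 Hp _].
  have T00 : 0 <= (0 : R) <= T by apply/andP; split => //; exact: ltW.
  have [q [qT _ Hq]] := ae_leb_near T0 T00 ltr01 Hp.
  have In0 : (0 <= \int[leb R]_(r in `[0%R, T]) (n r)%:E)%E.
    by apply: integral_ge0 => r /sub rT; rewrite lee_fin n0.
  have In : lebint T n.
    apply/integrableP; split; first exact/measurable_EFinP.
    have -> : (\int[leb R]_(x in `[0%R, T]) `|(EFin \o n) x| =
       \int[leb R]_(r in `[0%R, T]) (n r)%:E)%E.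
      by apply: eq_integral => r; rewrite inE => /sub rT /=; rewrite ger0_norm// n0.
    apply: le_lt_trans (ltry N0); apply: le_trans Hq.
    by rewrite leeDl// lee_fin f0.
  have fN : {ae leb R, forall t : R, 0 <= t <= T -> f t <= N0}.
    apply: ae_lebS Hp => t Ht tT; rewrite -lee_fin; apply: le_trans (Ht tT).
    by rewrite leeDr.
  exists (fun t => N0 * n t), (fun=> 0), [set t | f t <= N0]; split.
  - apply: (lebint_ae_le mf (lebint_cst T N0)).
    by apply: ae_lebS fN => t h tT; rewrite ger0_norm ?f0// h.
  - split; first by move=> t tT; rewrite mulr_ge0 ?n0// (le_trans ler01 N1).
    exact: lebintZ.
  - by split => //; exact: lebint_cst.
  - exact: fN.
  - by move=> q' r /= fq _ _ rT; rewrite addr0 ler_wpM2r// n0.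
have q1 : 1 <= p / (p - 1).
  by rewrite ler_pdivlMr ?subr_gt0// mul1r gerBl ler01.
pose al t := n t `^ p; pose be t := f t `^ (p / (p - 1)).
have mpow (a : R -> R) (x : R) : measurable_fun (`[0, T]%classic : set L) (a : L -> R) ->
    measurable_fun (`[0, T]%classic : set L) ((fun t => a t `^ x) : L -> R).
  move=> ma mD Y mY; have mY' := @measurable_powR R x measurableT Y mY.
  by have := ma mD _ mY'; rewrite setTI.
have mal : measurable_fun (`[0, T]%classic : set L) (al : L -> R).
  exact: mpow.
have mbe : measurable_fun (`[0, T]%classic : set L) (be : L -> R).
  exact: mpow.
have msum : measurable_fun (`[0, T]%classic : set L) ((fun t => al t + be t) : L -> R).
  exact: measurable_funD.
have Isum : lebint T (fun t => al t + be t).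
  apply/integrableP; split; first exact/measurable_EFinP.
  have -> : (\int[leb R]_(x in `[0%R, T]) `|(EFin \o (fun t => al t + be t)%R) x| =
     \int[leb R]_(t in `[0%R, T]) (n t `^ p + f t `^ (p / (p - 1)))%:E)%E.
    by apply: eq_integral => r _ /=; rewrite ger0_norm// addr_ge0 ?powR_ge0.
  by apply: le_lt_trans (ltry N0); exact: Hp.
have Ial : lebint T al.
  apply: (lebint_le mal Isum) => t tT.
  by rewrite ger0_norm ?powR_ge0// lerDl powR_ge0.
have Ibe : lebint T be.
  apply: (lebint_le mbe Isum) => t tT.
  by rewrite ger0_norm ?powR_ge0// lerDr powR_ge0.
exists al, be, setT; split.
- apply: (lebint_le mf (lebintD (lebint_cst T 1) Ibe)) => t tT.
  by rewrite ger0_norm ?f0// le_1_powR// f0.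
- by split => // t _; exact: powR_ge0.
- by split => // t _; exact: powR_ge0.
- by apply: (@filterE _ _ ae_leb_filter).
- by move=> q r _ _ qT rT; apply: young_le => //; [exact: n0|exact: f0].
Qed.

End Assemble.

(** * The theorem *)

Theorem theorem1p4 (R : realType)
  (V : completeNormedModType R[i])
  (H : completeNormedModType R[i])
  (ip : {dot H for @Num.conj R[i]})
  (H_hilbert : inner_product_norm ip)
  (inc : {linear V -> H})
  (inc_inj : injective inc)
  (inc_norm : forall v : V, rnorm (inc v) <= rnorm v)
  (T p : R) (T_gt0 : 0 < T) (p_ge1 : 1 <= p)
  (v : R -> V)
  (v_meas : strongly_measurable (leb R) `[0, T] v)
  (vs : R -> antidual V)
  (vs_meas : forall x : V,
     measurable_complex (`[0, T] : set (lebesgueType R)) (fun t => vs t x))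
  (f : R -> R)
  (f_meas : measurable_fun (`[0, T] : set (lebesgueType R)) f)
  (vs_le_f : forall t : R, 0 <= t <= T -> dual_norm (vs t) <= f t)
  (N0 : R) (N0_ge1 : 1 <= N0)
  (bound_p_gt1 : 1 < p ->
     (\int[leb R]_(t in `[0%R, T])
        (rnorm (v t) `^ p + f t `^ (p / (p - 1)))%:E <= N0%:E)%E)
  (bound_p_eq1 : p = 1 ->
     {ae leb R, forall t : R, 0 <= t <= T ->
        (\int[leb R]_(r in `[0%R, T]) (rnorm (v r))%:E + (f t)%:E <= N0%:E)%E})
  (v_weak : forall x : V,
     {ae (leb R \x leb R)%E, forall st : R * R,
        0 <= st.1 <= T -> 0 <= st.2 <= T ->
        ip (inc (v st.2)) (inc x) - ip (inc (v st.1)) (inc x) =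
        oriented_integral st.1 st.2 (fun r => vs r x)}) :
  exists u : R -> H,
    [/\ {within `[0, T], continuous u},
        {ae leb R, forall t : R, 0 <= t <= T -> u t = inc (v t)},
        forall (t : R) (x : V), 0 <= t <= T ->
          ip (u t) (inc x) =
          ip (u 0) (inc x) + oriented_integral 0 t (fun s => vs s x)
      & forall t : R, 0 <= t <= T ->
          rnorm (u t) ^+ 2 =
          rnorm (u 0) ^+ 2 +
          2 * \int[leb R]_(s in `[0, t])
                complex.Re (pairingH inc (vs s) (u s))].
Proof.
have [s [ms cs]] := v_meas.
have scvg : {ae leb R, forall t : R, 0 <= t <= T -> s n t @[n --> \oo] --> v t}.
  by apply: ae_lebS cs => t ct tT; apply: ct; rewrite /= in_itv.
have sfin n : finite_set (range (s n)) by exact: fimfunP.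
pose rho t x := complex.Re (vs t x).
have f0 t : 0 <= t <= T -> 0 <= f t.
  by move=> tT; exact: (le_trans (dual_norm_ge0 _) (vs_le_f t tT)).
have rho_le t x : 0 <= t <= T -> `|rho t x| <= f t * rnorm x.
  move=> tT; apply: le_trans (Re_le_rnorm _) _.
  apply: le_trans (rnorm_antidual_le _ _) _.
  by rewrite ler_wpM2r ?rnorm_ge0// vs_le_f.
have rho_meas x := (vs_meas x).1.
have mnv : measurable_fun (`[0, T]%classic : set (lebesgueType R))
    ((fun t => rnorm (v t)) : lebesgueType R -> R).
  apply: (@measurable_strong_limit _ _ _ (fun _ x => rnorm x) s) => //.
  apply: ae_lebS scvg => t ct tT; apply/cvgrPdist_lt => e e0.
  have : \forall n \near \oo, rnorm (v t - s n t) < e.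
    by move/rnorm_cvgP : (ct tT) => /(_ e e0).
  apply: filterS => n; exact: le_lt_trans (ler_rnormB _ _).
have [al [be [S [fint [al0 ial] [be0 ibe] aeS yg]]]] :=
  young_majorant T_gt0 p_ge1 N0_ge1 (fun t _ => rnorm_ge0 (v t)) f0 mnv f_meas
    bound_p_gt1 bound_p_eq1.
have rint x : lebint T (fun r => complex.Re (vs r x)).
  by apply: (rho_int rho_le) => //.
have wk x := weak_primitive T_gt0 (rint x) (v_weak x).
have [u [cu ug wu nu]] := energy_equality H_hilbert inc_norm T_gt0 sfin ms scvg
  (fun t x y => antidual_ReB (vs t) x y) rho_le rho_meas f0 fint al0 ial be0 ibe aeS yg wk.
exists u; split => //.
- exact: eps_continuous_vec_within.
- move=> t x /[dup] tT /andP[t0 tT'].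
  have T00 : 0 <= (0 : R) <= T by rewrite lexx ltW.
  rewrite /oriented_integral t0; apply/eqP; rewrite eq_complex; apply/andP; split; apply/eqP.
    by rewrite ReD; exact: wu.
  have ImD (z w : R[i]) : complex.Im (z + w) = complex.Im z + complex.Im w.
    by case: z; case: w.
  rewrite ImD !ip_Im.
  have := wu t ('i%C *: x) tT.
  have -> : inc ('i%C *: x) = 'i%C *: inc x by exact: linearZ.
  move=> ->; congr (_ + _); rewrite /primitive /=.
  by apply: eq_Rintegral => r _; rewrite antidual_Im.
- move=> t /[dup] tT /andP[t0 tT'].
  rewrite nu//; congr (_ + 2 * _); apply/esym.
  apply: (ae_eq_primitive (T := T)) => //.
    exact: (pairing_int sfin ms scvg (fun t x y => antidual_ReB (vs t) x y)
      rho_le rho_meas f0 ial ibe aeS yg).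
  apply: ae_lebS ug => r ur rT; rewrite ur// pairingH_inc//.
Qed.
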